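(* Let $H$ be a $4$-edge-connected $3$-hypergraph. If no $3$-hyperedge of $H$ is included in any edge-cut of $H$ of size $4$, then $H$ contains a quasitree with tight complement, i.e. there is a quasigraph $\pi$ in $H$ that is a quasitree and has tight complement in $H$.
   Context: A $3$-hypergraph $H$ consists of a finite vertex set $V=V(H)$ and a finite multiset $E(H)$ of hyperedges, each a subset of $V$ of cardinality $2$ or $3$; multiple copies of a hyperedge are allowed and regarded as distinct hyperedges. A $k$-hyperedge is a hyperedge of cardinality $k$. $H$ is connected if for every nonempty proper subset $X\subseteq V$ some hyperedge meets both $X$ and $V-X$. If $H$ is connected, an edge-cut in $H$ is an inclusionwise minimal set $F$ of hyperedges such that $H-F$ is disconnected. $H$ is $k$-edge-connected if it is connected and contains no edge-cut of cardinality less than $k$. A quasigraph in $H$ is a function $\pi$ assigning to each hyperedge $e$ of $H$ a set $\pi(e)\subseteq e$ that is either empty or of cardinality $2$. A hyperedge $e$ is used by $\pi$ if $\pi(e)\neq\emptyset$; $E(\pi)$ is the set of used hyperedges. $\pi^*$ is the (multi)graph with vertex set $V$ whose edges are the nonempty sets $\pi(e)$, one for each $e\in E(\pi)$. $\pi$ is a quasitree if $\pi^*$ is a tree (spanning $V$). The complement $\overline{\pi}$ of $\pi$ is the hypergraph with vertex set $V$ whose hyperedges are the hyperedges of $H$ not used by $\pi$. For $X\subseteq V$, the $\pi$-section $H[X]^{\pi}$ is the hypergraph with vertex set $X$ whose hyperedges are the sets $e\cap X$ (one copy for each such $e$), where $e$ is a hyperedge of $H$ with $|e\cap X|\ge 2$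 and $\pi(e)\subseteq X$. The induced quasigraph $\pi[X]$ in $H[X]^{\pi}$ is defined by $(\pi[X])(e\cap X)=\pi(e)$. $\pi$ has tight complement in $H$ (recursive definition) if (a) $\overline{\pi}$ is connected, or (b) there is a partition $V=X_1\cup X_2$ into nonempty disjoint sets such that for $i=1,2$, $\pi[X_i]$ has tight complement in $H[X_i]^{\pi}$, and there is a hyperedge $e\in E(\pi)$ such that $\pi(e)\subseteq X_1$ and $e\cap X_2\neq\emptyset$. *)

(* Defs.v *)
From mathcomp Require Import all_boot.

Set Implicit Arguments.
Unset Strict Implicit.
Unset Printing Implicit Defensive.

(* Multiset of hyperedges: [edges] is a finite set of labels and [ends e] the
   vertex subset carried by the label [e], so parallel hyperedges are distinct
   labels.  Vertices and labels are subsets of ambient finite types so that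
   sections and complements live over the same types; [ends] is irrelevant
   outside [edges]. *)
Record hypergraph (V E : finType) := Hypergraph {
  verts : {set V};
  edges : {set E};
  ends : E -> {set V}
}.

Section Hypergraphs.
Variables V E : finType.
Implicit Types (H G : hypergraph V E) (pi : E -> {set V}).
Implicit Types (X : {set V}) (F : {set E}) (e : E).

Definition hypergraph3 H : Prop :=
  forall e, e \in edges H ->
    ends H e \subset verts H /\ (#|ends H e| = 2 \/ #|ends H e| = 3).

Definition meets (A B : {set V}) : bool := A :&: B != set0.

Definition connected H : bool :=
  [forall X : {set V}, (X \subset verts H) && (X != set0) && (X != verts H) ==>
    [exists e in edges H,
      meets (ends H e) X && meets (ends H e) (verts H :\: X)]].

Definition del_edges H F : hypergraph V E :=
  Hypergraph (verts H) (edges H :\: F) (ends H).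

(* Used for connected H only. *)
Definition edge_cut H F : bool :=
  minset (fun F' => (F' \subset edges H) && ~~ connected (del_edges H F')) F.

Definition edge_connected (k : nat) H : Prop :=
  connected H /\ forall F, edge_cut H F -> k <= #|F|.

(* The values of [pi] outside [edges H] are irrelevant. *)
Definition quasigraph H pi : Prop :=
  forall e, e \in edges H ->
    pi e \subset ends H e /\ (pi e = set0 \/ #|pi e| = 2).

Definition used H pi : {set E} := [set e in edges H | pi e != set0].

(* The multigraph pi^*, seen as a hypergraph with hyperedges of size 2. *)
Definition star H pi : hypergraph V E := Hypergraph (verts H) (used H pi) pi.

(* A cycle with vertices v_1, ..., v_k and edges e_1, ..., e_k (k >= 1), e_i
   joining v_i to v_(i+1) cyclically; two parallel edges form a cycle with
   k = 2. *)
Definition graph_cycle G (vs : seq V) (es : seq E) : bool :=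
  [&& 0 < size es, uniq vs, uniq es, all [in edges G] es &
      all2 (fun e (p : V * V) => ends G e == [set p.1; p.2])
           es (zip vs (rot 1 vs))].

Definition tree G : Prop :=
  connected G /\ forall vs es, ~~ graph_cycle G vs es.

Definition quasitree H pi : Prop := quasigraph H pi /\ tree (star H pi).

Definition complement H pi : hypergraph V E := del_edges H (used H pi).

(* The pi-section H[X]^pi; a hyperedge keeps its label, so the induced
   quasigraph pi[X], which sends e :&: X to pi(e), is again [pi]. *)
Definition section H pi X : hypergraph V E :=
  Hypergraph X
    [set e in edges H | (2 <= #|ends H e :&: X|) && (pi e \subset X)]
    (fun e => ends H e :&: X).

Inductive tight_complement pi : hypergraph V E -> Prop :=
| TightConnected H :
    connected (complement H pi) -> tight_complement pi H
| TightSplit H (X1 X2 : {set V}) :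
    X1 :|: X2 = verts H -> [disjoint X1 & X2] ->
    X1 != set0 -> X2 != set0 ->
    tight_complement pi (section H pi X1) ->
    tight_complement pi (section H pi X2) ->
    (exists e, [/\ e \in used H pi, pi e \subset X1 & meets (ends H e) X2]) ->
    tight_complement pi H.

End Hypergraphs.

(* Main.v *)
Require Import Defs.
From mathcomp Require Import all_boot.

Set Implicit Arguments.
Unset Strict Implicit.
Unset Printing Implicit Defensive.

(** A quasigraph [pi] has tight complement iff every nontrivial partition of the
    vertices is crossed by a hyperedge [e] such that [pi e] does not cross it.

    For an acyclic [pi], refine the trivial partition alternately into components
    of [pi] and into anticomponents (the largest sets that no partition of the
    above kind separates).  A hyperedge [e] with [pi e] inside a class that joins
    two components of a class [X] and lies there on a cycle of such hyperedges is
    redundant for the tightness of [X]; it is then discarded, that is, it no longer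
    counts for the refinements inside smaller classes.  Choose [pi] for which these
    partitions are lexicographically as coarse as possible.  An unused hyperedge
    that is redundant in [X] could be used to join two components of [X]: if this
    closes a cycle of [pi], an edge [g] of the cycle was dropped earlier, either by
    an anticomponent step, which becomes coarser once [g] is unused, or because [g]
    was discarded, and then [g] is redundant and unused at an earlier stage.

    Hence in the last partition, with [n] classes, the hyperedges used across
    classes form a forest and the others have no cycle.  Let [w] be the number of
    classes incident with a 3-hyperedge.  By the cut conditions the degrees sum to
    at least [4n + w].  If [n > 1], the forest has at most [n - 1] hyperedges, of
    which at most [w] have size 3, so it contributes at most [2(n - 1) + w], and the
    others contribute at most [2(n - 1)], a contradiction. *)

(** * Walks in a finite relation *)

Section Connect.
Variable T : finType.
Implicit Types (e : rel T).

Lemma connect_inv e (P : T -> T -> Prop) x y :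
    (forall u, P u u) -> (forall u v w, P u v -> P v w -> P u w) ->
    (forall u v, e u v -> P u v) -> connect e x y -> P x y.
Proof.
move=> Pxx Ptr Pe /connectP[p]; elim: p x => [|z p IHp] x /=.
  by move=> _ ->.
by case/andP=> exz pz eqy; apply: Ptr (Pe _ _ exz) (IHp _ pz eqy).
Qed.

Lemma connect_cut e (A : pred T) x y :
  connect e x y -> A x -> ~~ A y -> exists u v, [/\ e u v, A u & ~~ A v].
Proof.
case/connectP=> p; elim: p x => [|z p IHp] x /=.
  by move=> _ -> ->.
case/andP=> exz pz eqy Ax Ay; case Az: (A z); last by exists x, z; rewrite Az.
exact: IHp pz eqy Az Ay.
Qed.

End Connect.

(** * The graph formed by the parts of a quasigraph on a set of hyperedges *)

Section Quasigraphs.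
Variables V E : finType.
Implicit Types (pi : {ffun E -> {set V}}) (D L : {set E}) (X : {set V}).

Definition edge_rel pi D : rel V := fun x y => [exists f in D, pi f == [set x; y]].

Lemma edge_relP pi D x y :
  reflect (exists2 f, f \in D & pi f = [set x; y]) (edge_rel pi D x y).
Proof. by apply: (iffP exists_inP) => -[f fD /eqP]; exists f => //; apply/eqP. Qed.

Lemma edge_rel_sym pi D : symmetric (edge_rel pi D).
Proof. by move=> x y; apply: eq_existsb => f; rewrite setUC. Qed.

Lemma edge_conn_sym pi D : connect_sym (edge_rel pi D).
Proof. exact/sym_connect_sym/edge_rel_sym. Qed.

Lemma edge_conn_sub pi pi' D D' x y :
    (forall f, f \in D -> pi f != set0 -> f \in D' /\ pi' f = pi f) ->
  connect (edge_rel pi D) x y -> connect (edge_rel pi' D') x y.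
Proof.
move=> sub; apply: connect_sub => u v /edge_relP[f fD ef]; apply: connect1.
have [| fD' ef'] := sub f fD; last by apply/edge_relP; exists f; rewrite ?ef'.
by rewrite ef; apply/set0Pn; exists u; rewrite set21.
Qed.

Lemma set2_inj (x y z w : V) :
  [set x; y] = [set z; w] -> (x = z /\ y = w) \/ (x = w /\ y = z).
Proof.
move=> eq2; have := set21 x y; have := set22 x y; have := set21 z w; have := set22 z w.
rewrite -{1 2}eq2 {3 4}eq2 !inE.
by do 4![case/orP=> /eqP ?]; subst; auto.
Qed.

(* A walk that uses the edge [g] can be cut before its first and after its last use. *)
Lemma edge_conn_del pi D g z w x y : pi g = [set z; w] ->
  connect (edge_rel pi D) x y ->
  [\/ connect (edge_rel pi (D :\ g)) x y,
      connect (edge_rel pi (D :\ g)) x z /\ connect (edge_rel pi (D :\ g)) w y |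
      connect (edge_rel pi (D :\ g)) x w /\ connect (edge_rel pi (D :\ g)) z y].
Proof.
move=> eg /connectP[p]; elim: p x => [|u p IHp] x /=; first by move=> _ ->; constructor 1.
case/andP=> /edge_relP[f fD ef] /IHp{}IHp /IHp{IHp}.
case: (eqVneq f g) => [fg|fg].
  move: ef; rewrite fg eg => /set2_inj[[zx wu]|[zu wx]]; rewrite -?zx -?wu -?zu -?wx.
    by case=> [?|[_ ?]|[_ ?]]; [constructor 2|constructor 2|constructor 1].
  by case=> [?|[_ ?]|[_ ?]]; [constructor 3|constructor 1|constructor 3].
have xu: connect (edge_rel pi (D :\ g)) x u.
  by apply/connect1/edge_relP; exists f; rewrite // !inE fg.
case=> [uy|[uz wy]|[uw zy]].
- by constructor 1; apply: connect_trans uy.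
- by constructor 2; split=> //; apply: connect_trans uz.
- by constructor 3; split=> //; apply: connect_trans uw.
Qed.

Definition upd pi e X : {ffun E -> {set V}} := [ffun f => if f == e then X else pi f].

Lemma updE pi e X f : upd pi e X f = if f == e then X else pi f.
Proof. by rewrite ffunE. Qed.

End Quasigraphs.

(** * Forests *)

Section Forests.
Variables (V E : finType) (E0 : {set E}) (s : E -> {set V}).
Implicit Types (pi : {ffun E -> {set V}}) (D L : {set E}).

(** Parts must be empty outside [E0], so that connectivity in [pi] can be taken over all labels. *)
Definition shrinking pi : bool :=
  [forall f, (pi f != set0) ==> [&& f \in E0, pi f \subset s f & #|pi f| == 2]].

(** Acyclicity is encoded as every edge being a bridge; edges are removed as labels, so parallel
    edges are covered. *)
Definition forest pi : bool := (shrinking pi &&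
  [forall f, forall x, forall y, (pi f == [set x; y]) ==>
     ~~ connect (edge_rel pi (setT :\ f)) x y]).

Lemma shrinkingP pi f : shrinking pi -> pi f != set0 ->
  [/\ f \in E0, pi f \subset s f & #|pi f| = 2].
Proof. by move=> /forallP/(_ f)/implyP h /h/and3P[? ? /eqP]. Qed.

Lemma forest_shrinking pi : forest pi -> shrinking pi.
Proof. by case/andP. Qed.

Lemma forest_bridge pi f x y :
  forest pi -> pi f = [set x; y] -> ~~ connect (edge_rel pi (setT :\ f)) x y.
Proof.
by case/andP=> _ /forallP/(_ f)/forallP/(_ x)/forallP/(_ y)/implyP h /eqP.
Qed.

Lemma forest_set0 : forest [ffun=> set0].
Proof.
apply/andP; split; apply/forallP=> f; first by rewrite ffunE eqxx.
apply/forallP=> x; apply/forallP=> y; apply/implyP; rewrite ffunE => /eqP e0.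
by have:= set21 x y; rewrite -e0 inE.
Qed.

Lemma forest_del pi g : forest pi -> forest (upd pi g set0).
Proof.
move=> pi_f; apply/andP; split; apply/forallP=> f.
  rewrite updE; case: (f == g); rewrite ?eqxx //.
  exact: (forallP (forest_shrinking pi_f) f).
apply/forallP=> x; apply/forallP=> y; apply/implyP; rewrite updE.
case: (f == g) => /eqP ef.
  by have:= set21 x y; rewrite -ef inE.
apply: contra (forest_bridge pi_f ef); apply: edge_conn_sub => h hf; rewrite updE.
by case: (h == g); rewrite ?eqxx.
Qed.

(** If an older edge [f] were no longer a bridge, a walk around it would use [e]; the rest of this
    walk together with [f] would join [a] to [b] in [pi]. *)
Lemma forest_add pi e a b :
    forest pi -> pi e = set0 -> e \in E0 -> a \in s e -> b \in s e ->
  ~~ connect (edge_rel pi setT) a b -> forest (upd pi e [set a; b]).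
Proof.
move=> pi_f pie0 eE ae be nab.
have neq_ab : a != b by apply: contraNneq nab => ->.
have old D x y : connect (edge_rel (upd pi e [set a; b]) (D :\ e)) x y ->
    connect (edge_rel pi D) x y.
  apply: edge_conn_sub => h; rewrite !inE updE.
  by case/andP=> /negPf -> hD _.
have subT D x y : connect (edge_rel pi D) x y -> connect (edge_rel pi setT) x y.
  by apply: edge_conn_sub => h _; rewrite inE.
apply/andP; split; apply/forallP=> f.
  rewrite updE; case: (eqVneq f e) => [->|_]; last exact: (forallP (forest_shrinking pi_f) f).
  by rewrite eE cards2 neq_ab subUset !sub1set ae be implybT.
apply/forallP=> x; apply/forallP=> y; apply/implyP; rewrite updE.
case: (eqVneq f e) => [->|fe] /eqP ef.
  apply/negP=> /old cxy; case/negP: nab.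
  by case: (set2_inj ef) => -[-> ->] //; rewrite edge_conn_sym.
apply/negP=> cxy.
have ee : upd pi e [set a; b] e = [set a; b] by rewrite updE eqxx.
have xy : connect (edge_rel pi setT) x y.
  by apply/connect1/edge_relP; exists f; rewrite ?inE.
case: (edge_conn_del ee cxy) => [/old h|[/old/subT h1 /old/subT h2]|[/old/subT h1 /old/subT h2]].
- by case/negP: (forest_bridge pi_f ef).
- case/negP: nab; rewrite edge_conn_sym; apply: connect_trans h2 _.
  by rewrite edge_conn_sym; apply: connect_trans xy; rewrite edge_conn_sym.
- case/negP: nab; apply: connect_trans h2 _.
  by rewrite edge_conn_sym; apply: connect_trans xy; rewrite edge_conn_sym.
Qed.

(** A minimal subset of [D] that joins [a] to [b] is the edge set of their path. It is not contained
    in [D1], and each of its edges separates [a] from [b] in the forest. *)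
Lemma separating_edge pi D D1 a b : forest pi ->
    connect (edge_rel pi D) a b -> ~~ connect (edge_rel pi D1) a b ->
  exists g z w, [/\ g \in D, g \notin D1, pi g = [set z; w],
    connect (edge_rel pi (D :\ g)) a z /\ connect (edge_rel pi (D :\ g)) w b &
    ~~ connect (edge_rel pi (setT :\ g)) a b].
Proof.
move=> pi_f cD nD1.
have [D' minD' subD'] := @minset_exists _ (fun D' => connect (edge_rel pi D') a b) D cD.
have [cD' minP] := minsetP minD'.
have [g gD' gD1] : exists2 g, g \in D' & g \notin D1.
  apply/subsetPn; apply: contra nD1 => sD'; apply: edge_conn_sub cD' => f fD _.
  by split=> //; apply: (subsetP sD').
have nDg : ~~ connect (edge_rel pi (D' :\ g)) a b.
  apply/negP=> c; have /setP/(_ g) := minP _ c (subsetDl _ _).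
  by rewrite gD' !inE eqxx.
have pig0 : pi g != set0.
  apply: contraNneq nDg => pig; apply: edge_conn_sub cD' => f fD' fn0; split=> //.
  by rewrite !inE fD' andbT; apply: contraNneq fn0 => ->; rewrite pig.
have [_ _ /eqP/cards2P[z [w [nzw eg]]]] := shrinkingP (forest_shrinking pi_f) pig0.
have up x y : connect (edge_rel pi (D' :\ g)) x y -> connect (edge_rel pi (D :\ g)) x y.
  by apply: edge_conn_sub => f; rewrite !inE => /andP[-> /(subsetP subD')].
have upT x y : connect (edge_rel pi (D' :\ g)) x y -> connect (edge_rel pi (setT :\ g)) x y.
  by apply: edge_conn_sub => f; rewrite !inE => /andP[->].
have gD := subsetP subD' _ gD'.
have sep x y : pi g = [set x; y] ->
    connect (edge_rel pi (D' :\ g)) a x -> connect (edge_rel pi (D' :\ g)) y b ->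
    ~~ connect (edge_rel pi (setT :\ g)) a b.
  move=> eg' /upT ax /upT yb; apply: contra (forest_bridge pi_f eg') => ab.
  rewrite edge_conn_sym; apply: connect_trans yb _.
  by rewrite edge_conn_sym; apply: connect_trans ab; rewrite edge_conn_sym.
case: (edge_conn_del eg cD') => [|[az wb]|[aw zb]]; first by rewrite (negPf nDg).
  by exists g, z, w; split; auto; apply: sep az wb.
have eg' : pi g = [set w; z] by rewrite eg setUC.
by exists g, w, z; split; auto; apply: sep aw zb.
Qed.

End Forests.

(** * The refinement process *)

Section Refinement.
Variables (V E : finType) (E0 : {set E}) (s : E -> {set V}).
Implicit Types (pi : {ffun E -> {set V}}) (B D L : {set E}) (X : {set V}).
Implicit Types (R K A P : {set V * V}) (l : {ffun V -> V}).

(** Relations are finite sets of pairs, so that they have cardinals to maximise and can be compared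
    by equality. *)
Record is_equiv R : Prop := IsEquiv {
  is_equiv_refl : forall x, (x, x) \in R;
  is_equiv_sym : forall x y, (x, y) \in R -> (y, x) \in R;
  is_equiv_trans : forall x y z, (x, y) \in R -> (y, z) \in R -> (x, z) \in R
}.

Definition within R X : bool := [forall x in X, forall y in X, (x, y) \in R].

Lemma withinP R X : reflect {in X &, forall x y, (x, y) \in R} (within R X).
Proof.
apply: (iffP forall_inP) => [h x y xX yX|h x xX]; first exact: (forall_inP (h x xX)).
by apply/forall_inP=> y; apply: h.
Qed.

Lemma within_sub R R' X : R \subset R' -> within R X -> within R' X.
Proof.
by move=> /subsetP sR /withinP h; apply/withinP=> x y xX yX; apply/sR/h.
Qed.

Lemma withinT X : within setT X.
Proof. by apply/withinP=> x y _ _; rewrite in_setT. Qed.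

Lemma within0 R : within R set0.
Proof. by apply/withinP=> x y; rewrite inE. Qed.

Definition constant_on l X : Prop := {in X &, forall x y, l x = l y}.

Definition alive pi R L : {set E} := [set f | (f \notin L) && within R (pi f)].

Definition comps pi R L : {set V * V} :=
  [set p | connect (edge_rel pi (alive pi R L)) p.1 p.2].

Lemma compsE pi R L x y :
  ((x, y) \in comps pi R L) = connect (edge_rel pi (alive pi R L)) x y.
Proof. by rewrite inE. Qed.

Lemma comps_equiv pi R L : is_equiv (comps pi R L).
Proof.
split=> [x|x y|x y z]; rewrite !compsE ?connect0 // ?[connect _ y _]edge_conn_sym //.
by rewrite [connect _ z y]edge_conn_sym; apply: connect_trans.
Qed.

Lemma comps_sub pi R L : is_equiv R -> comps pi R L \subset R.
Proof.
move=> [Rr Rs Rt]; apply/subsetP=> -[x y]; rewrite compsE.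
apply: (connect_inv (P := fun u v => (u, v) \in R)) => //.
move=> u v /edge_relP[f]; rewrite inE => /andP[_ /withinP wf] ef.
by apply: wf; rewrite ef ?set21 ?set22.
Qed.

(* [merge_closed] and [anti] describe tightness inside the classes of [K]: a hyperedge that
   is not discarded, and whose [pi]-part lies in the class of [x], merges all its
   vertices in this class as soon as its [pi]-part has been merged. *)
Definition merge_closed pi K L l : bool :=
  [forall e, forall x in s e, forall y in s e,
    [&& e \notin L, (x, y) \in K, [forall z in pi e, (z, x) \in K] &
        [forall z in pi e, forall w in pi e, l z == l w]] ==> (l x == l y)].

Lemma merge_closedP pi K L l :
  reflect (forall e x y, e \notin L -> x \in s e -> y \in s e -> (x, y) \in K ->
             (forall z, z \in pi e -> (z, x) \in K) -> constant_on l (pi e) -> l x = l y)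
    (merge_closed pi K L l).
Proof.
apply: (iffP forallP) => h e.
  move=> x y eL xe ye Kxy Kx lc; apply/eqP.
  apply: (implyP (forall_inP (forall_inP (h e) x xe) y ye)).
  rewrite eL Kxy /=; apply/andP; split; first exact/forall_inP.
  by apply/forall_inP=> z ze; apply/forall_inP=> w we; rewrite (lc z w).
apply/forall_inP=> x xe; apply/forall_inP=> y ye; apply/implyP.
case/and4P=> eL Kxy /forall_inP Kx /forall_inP lc; apply/eqP; apply: (h e) => //.
by move=> z w ze we; apply/eqP; apply: (forall_inP (lc z ze)).
Qed.

Definition anti pi K L : {set V * V} :=
  [set p in K | [forall l, merge_closed pi K L l ==> (l p.1 == l p.2)]].

Lemma antiP pi K L x y :
  reflect ((x, y) \in K /\ forall l, merge_closed pi K L l -> l x = l y)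
    ((x, y) \in anti pi K L).
Proof.
rewrite inE; apply: (iffP andP) => -[Kxy h]; split=> //.
  by move=> l lc; apply/eqP; have /forallP/(_ l)/implyP-> := h.
by apply/forallP=> l; apply/implyP=> lc; rewrite (h l lc).
Qed.

Lemma anti_sub pi K L : anti pi K L \subset K.
Proof. by apply/subsetP=> p; rewrite inE => /andP[]. Qed.

Lemma anti_equiv pi K L : is_equiv K -> is_equiv (anti pi K L).
Proof.
move=> [Kr Ks Kt]; split=> [x|x y|x y z].
- exact/antiP.
- by case/antiP=> Kxy h; apply/antiP; split; [apply: Ks|move=> l lc; rewrite h].
- case/antiP=> Kxy h /antiP[Kyz h']; apply/antiP; split; first exact: Kt Kyz.
  by move=> l lc; rewrite h ?h'.
Qed.

(** Adjacency after contraction of the classes of [A], through those hyperedges of [B] whose part is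
    contracted or empty. *)
Definition adj pi R A B : rel V := fun p q =>
  ((p, q) \in A) ||
  [exists f in B, [&& within A (pi f), p \in s f, q \in s f & (p, q) \in R]].

Lemma adjP pi R A B p q :
  reflect ((p, q) \in A \/
    exists f, [/\ f \in B, within A (pi f), p \in s f, q \in s f & (p, q) \in R])
    (adj pi R A B p q).
Proof.
apply: (iffP orP) => -[pq|].
- by left.
- by case/exists_inP=> f fB /and4P[]; right; exists f.
- by left.
- by case=> f [fB w pf qf Rpq]; right; apply/exists_inP; exists f => //; apply/and4P.
Qed.

(** The redundant hyperedges of one stage: they join two components of a class of [R] and lie there
    on a cycle modulo [A]. *)
Definition lost pi R K A L : {set E} :=
  [set e | [&& e \notin L, within A (pi e) & [exists x in s e, exists y in s e,
     [&& (x, y) \in R, (x, y) \notin K & connect (adj pi R A (~: L :\ e)) x y]]]].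

Lemma lostP pi R K A L e :
  reflect [/\ e \notin L, within A (pi e) & exists x y,
     [/\ x \in s e /\ y \in s e, (x, y) \in R, (x, y) \notin K &
         connect (adj pi R A (~: L :\ e)) x y]]
    (e \in lost pi R K A L).
Proof.
rewrite inE; apply: (iffP and3P) => -[eL we].
  case/exists_inP=> x xe /exists_inP[y ye /and3P[]]; split=> //; exists x, y; split=> //.
case=> x [y [[xe ye] Rxy Kxy cxy]]; split=> //.
by apply/exists_inP; exists x => //; apply/exists_inP; exists y => //; apply/and3P.
Qed.

Lemma eq_lost pi pi' R K A L :
  (forall f, within A (pi' f) = within A (pi f)) -> lost pi' R K A L = lost pi R K A L.
Proof.
move=> ww; have adjE B : adj pi' R A B =2 adj pi R A B.
  by move=> p q; congr orb; apply: eq_existsb => f; rewrite ww.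
apply/setP=> e; apply/lostP/lostP=> -[eL we [x [y [xye Rxy Kxy cxy]]]].
  split; rewrite -?ww //; exists x, y; split=> //.
  by rewrite -(eq_connect (adjE _)).
split; rewrite ?ww //; exists x, y; split=> //.
by rewrite (eq_connect (adjE _)).
Qed.

(** Labels outside [E0] are discarded from the start, so that a label that is not discarded is
    always a hyperedge. *)
Fixpoint state pi (i : nat) : {set V * V} * {set E} :=
  if i is j.+1 then
    let: (R, L) := state pi j in
    let K := comps pi R L in
    let A := anti pi K L in (A, L :|: lost pi R K A L)
  else (setT, ~: E0).

(* Sealed, since the unifier would otherwise unfold [state] when it compares the
   refinements of two quasigraphs. *)
Lemma sealed_state : {f | f = state}.
Proof. by exists state. Qed.

Definition Rel pi i := (sval sealed_state pi i).1.
Definition Lost pi i := (sval sealed_state pi i).2.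
Definition Comp pi i := comps pi (Rel pi i) (Lost pi i).

Lemma Rel0 pi : Rel pi 0 = setT. Proof. by rewrite /Rel (svalP sealed_state). Qed.

Lemma Lost0 pi : Lost pi 0 = ~: E0. Proof. by rewrite /Lost (svalP sealed_state). Qed.

Lemma RelS pi i : Rel pi i.+1 = anti pi (Comp pi i) (Lost pi i).
Proof. by rewrite /Comp /Rel /Lost (svalP sealed_state) /=; case: (state pi i). Qed.

Lemma LostS pi i : Lost pi i.+1 =
  Lost pi i :|: lost pi (Rel pi i) (Comp pi i) (Rel pi i.+1) (Lost pi i).
Proof. by rewrite RelS /Comp /Rel /Lost (svalP sealed_state) /=; case: (state pi i). Qed.

Lemma Rel_equiv pi i : is_equiv (Rel pi i).
Proof.
case: i => [|i]; first by rewrite Rel0; split=> *; rewrite inE.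
by rewrite RelS; apply/anti_equiv/comps_equiv.
Qed.

Lemma Comp_equiv pi i : is_equiv (Comp pi i). Proof. exact: comps_equiv. Qed.

Lemma Comp_sub_Rel pi i : Comp pi i \subset Rel pi i.
Proof. exact/comps_sub/Rel_equiv. Qed.

Lemma RelS_sub_Comp pi i : Rel pi i.+1 \subset Comp pi i.
Proof. by rewrite RelS anti_sub. Qed.

Lemma RelS_sub pi i : Rel pi i.+1 \subset Rel pi i.
Proof. exact: subset_trans (RelS_sub_Comp _ _) (Comp_sub_Rel _ _). Qed.

Lemma Rel_sub pi i j : i <= j -> Rel pi j \subset Rel pi i.
Proof.
elim: j => [|j IHj]; first by rewrite leqn0 => /eqP->.
by rewrite leq_eqVlt => /predU1P[->//|/IHj]; apply: subset_trans (RelS_sub _ _).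
Qed.

Lemma Rel_sub_Comp pi i j : i < j -> Rel pi j \subset Comp pi i.
Proof. by move/(Rel_sub pi)/subset_trans; apply; apply: RelS_sub_Comp. Qed.

Lemma Lost_sub pi i j : i <= j -> Lost pi i \subset Lost pi j.
Proof.
elim: j => [|j IHj]; first by rewrite leqn0 => /eqP->.
rewrite leq_eqVlt => /predU1P[->//|/IHj]/subset_trans; apply.
by rewrite LostS subsetUl.
Qed.

Lemma Lost_out pi i e : e \notin Lost pi i -> e \in E0.
Proof.
by apply: contraR => eE; apply: (subsetP (@Lost_sub pi 0 i isT)); rewrite Lost0 inE.
Qed.

Hypothesis card_s : [forall e in E0, #|s e| <= 3].

(** The refinement and exchange arguments use the bound 3 on the size of hyperedges only in this
    form: a nonempty part misses at most one vertex. *)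
Lemma two_of_three (X Y : {set V}) x y : X \subset Y -> #|X| = 2 -> #|Y| <= 3 ->
  x \in Y -> y \in Y -> x != y -> (x \in X) || (y \in X).
Proof.
move=> sXY cX cY xY yY nxy; apply: contraLR cY; rewrite negb_or => /andP[xX yX].
rewrite -ltnNge.
have : (x |: (y |: X)) \subset Y by rewrite !subUset !sub1set xY yY.
by move/subset_leq_card; rewrite !cardsU1 !inE negb_or nxy xX yX cX.
Qed.

(* A part that lies in one class and is constant for the label imposes the same
   condition as the empty part, since it contains one of any two vertices. *)
Lemma merge_closed_free pi K L l e x y : shrinking E0 s pi -> is_equiv K -> merge_closed pi K L l ->
    e \notin L -> e \in E0 -> within K (pi e) -> constant_on l (pi e) ->
  x \in s e -> y \in s e -> (x, y) \in K -> l x = l y.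
Proof.
move=> pi_s [Kr Ks Kt] /merge_closedP lc eL eE wK lK xe ye Kxy.
case: (eqVneq x y) => [->//|nxy].
apply: (lc e) => // z ze.
have pi0 : pi e != set0 by apply/set0Pn; exists z.
have [_ sub c2] := shrinkingP pi_s pi0.
case/orP: (two_of_three sub c2 (forall_inP card_s e eE) xe ye nxy) => [xp|yp].
  exact: (withinP _ _ wK).
by apply: Kt (Ks _ _ Kxy); apply: (withinP _ _ wK).
Qed.

(** Moves labelings from [pi] to a modified [pi'] at a finer stage. The second alternative works
    because a part with one class and one label merges as if it were empty ([merge_closed_free]),
    which is the strongest condition on labels. *)
Lemma merge_closed_transfer pi pi' K K' L L' l : shrinking E0 s pi -> is_equiv K ->
    merge_closed pi K L l -> K' \subset K -> L \subset L' -> ~: E0 \subset L' ->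
    (forall e, e \notin L' ->
       [\/ pi' e = pi e, within K (pi e) /\ constant_on l (pi e) |
           {in s e &, forall x y, (x, y) \in K' -> constant_on l (pi' e) -> l x = l y}]) ->
  merge_closed pi' K' L' l.
Proof.
move=> pi_s Ke lc /subsetP sK sL sE alt; apply/merge_closedP => e x y eL' xe ye Kxy wx lx.
have eL : e \notin L by apply: contra eL'; apply: (subsetP sL).
have eE : e \in E0 by apply: contraR eL' => h; apply: (subsetP sE); rewrite inE.
case: (alt e eL') => [e1|[wK lK]|h].
- move/merge_closedP: lc => /(_ e); apply=> //; rewrite -?e1 //; first exact: sK.
  by move=> z /wx /sK.
- exact: (merge_closed_free pi_s Ke lc eL eE wK lK xe ye (sK _ Kxy)).
- exact: h.
Qed.

(** The part of a linking hyperedge lies in a class of [A], hence carries one label, and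
    [merge_closed_free] makes the link preserve labels. *)
Lemma adj_label pi pi' R A L B l p q : shrinking E0 s pi' -> is_equiv R ->
    merge_closed pi' R L l -> (forall x y, (x, y) \in A -> l x = l y) -> A \subset R ->
    (forall f, f \in B -> [/\ f \in E0, f \notin L &
       within A (pi f) -> within A (pi' f)]) ->
  connect (adj pi R A B) p q -> l p = l q.
Proof.
move=> pi_s Re lc lA sAR hB.
apply: (connect_inv (P := fun u v => l u = l v)) => [//|u v w -> //|u v].
case/adjP=> [/lA//|[f [fB wf uf vf Ruv]]].
have [fE fL /(_ wf) wf'] := hB f fB.
apply: (merge_closed_free pi_s Re lc fL fE) => //; first exact: within_sub wf'.
by move=> z w zf wf0; apply/lA/(withinP _ _ wf').
Qed.

End Refinement.

(** * Optimal quasigraphs and the exchange argument *)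

Section Exchange.
Variables (V E : finType) (E0 : {set E}) (s : E -> {set V}).
Hypothesis card_s : [forall e in E0, #|s e| <= 3].
Implicit Types (pi : {ffun E -> {set V}}) (B D L : {set E}) (X : {set V}).
Implicit Types (R K A P : {set V * V}) (l : {ffun V -> V}).

Local Notation forest := (forest E0 s).
Local Notation shrinking := (shrinking E0 s).
Local Notation Rel := (Rel E0 s).
Local Notation Lost := (Lost E0 s).
Local Notation Comp := (Comp E0 s).
Local Notation merge_closed := (merge_closed s).

Definition agree pi' pi i : Prop :=
  Comp pi' i = Comp pi i /\ Rel pi' i.+1 = Rel pi i.+1.

(* The lexicographic order on the two cardinals. *)
Lemma sealed_cost : {c | forall pi i,
  c pi i = #|Comp pi i| * #|{: V * V}|.+1 + #|Rel pi i.+1|}.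
Proof. by exists (fun pi i => #|Comp pi i| * #|{: V * V}|.+1 + #|Rel pi i.+1|). Qed.

Definition cost := sval sealed_cost.

Lemma costE pi i : cost pi i = #|Comp pi i| * #|{: V * V}|.+1 + #|Rel pi i.+1|.
Proof. exact: (svalP sealed_cost). Qed.
(** Lexicographic maximality over the first [n] stages: only forests that agree with [pi] at all
    earlier stages compete at stage [i]. *)
Definition optimal n pi : Prop := forest pi /\
  forall pi' i, forest pi' -> i < n -> (forall k, k < i -> agree pi' pi k) ->
    cost pi' i <= cost pi i.

(** Among the forests tied in all earlier costs, one of maximal next cost is chosen. Agreement
    implies a tie in cost, so the choice beats every competitor. *)
Lemma optimal_exists n : exists pi, optimal n pi.
Proof.
suff [pi [pi_f pi_o]] : exists pi, forest pi /\ forall pi' i, forest pi' -> i < n ->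
    (forall k, k < i -> cost pi' k = cost pi k) -> cost pi' i <= cost pi i.
  exists pi; split; first exact: pi_f.
  move=> pi' i pi'_f lti tr; apply: pi_o pi'_f lti _ => k /tr[e1 e2].
  by rewrite !costE e1 e2.
elim: n => [|n [pi [pi_f IH]]].
  exists [ffun=> set0]; split; first exact: forest_set0.
  by move=> pi' i _; rewrite ltn0.
pose P pi' := forest pi' && [forall k : 'I_n, cost pi' k == cost pi k].
have P0 : P pi by rewrite /P pi_f; apply/forallP.
case: (@arg_maxnP _ pi P (fun pi' => cost pi' n) P0) => pi1 /andP[f1 /forallP c1] max1.
have c1' k : k < n -> cost pi1 k = cost pi k by move=> ltk; apply/eqP: (c1 (Ordinal ltk)).
exists pi1; split=> // pi' i pi'_f; rewrite ltnS leq_eqVlt => /predU1P[->|lti] tr.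
  apply: max1; rewrite /P pi'_f; apply/forallP=> k; apply/eqP.
  by rewrite tr ?c1'.
by rewrite c1' //; apply: IH => // k ltk; rewrite tr ?c1' //; apply: ltn_trans lti.
Qed.

Lemma optimal_le m n pi : m <= n -> optimal n pi -> optimal m pi.
Proof.
by move=> le_mn [pi_f o]; split=> // pi' i f' lti; apply: o => //; apply: leq_trans le_mn.
Qed.

(** A strictly larger [Comp] outweighs any loss in [Rel], whose cardinal is below the weight
    [#|{: V * V}|.+1]. *)
Lemma optimal_Comp n pi pi' i : optimal n pi -> forest pi' -> i < n ->
    (forall k, k < i -> agree pi' pi k) ->
  Comp pi i \subset Comp pi' i -> Comp pi' i = Comp pi i.
Proof.
move=> [_ o] pi'_f lti tr sub; apply/eqP; rewrite eq_sym eqEcard sub leqNgt.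
have:= o pi' i pi'_f lti tr; apply: contraTN; rewrite -ltnNge !costE => lt_c.
apply: leq_trans (leq_addr _ _); apply: (@leq_trans (#|Comp pi i|.+1 * #|{: V * V}|.+1)).
  by rewrite mulSn addnC -addSn leq_add2r ltnS max_card.
by rewrite leq_mul2r lt_c orbT.
Qed.

Lemma optimal_Rel n pi pi' i : optimal n pi -> forest pi' -> i < n ->
    (forall k, k < i -> agree pi' pi k) -> Comp pi' i = Comp pi i ->
  Rel pi i.+1 \subset Rel pi' i.+1 -> Rel pi' i.+1 = Rel pi i.+1.
Proof.
move=> [_ o] pi'_f lti tr eK sub; apply/eqP; rewrite eq_sym eqEcard sub.
by have:= o pi' i pi'_f lti tr; rewrite !costE eK leq_add2l.
Qed.

Lemma shrinking_upd pi e a b : shrinking pi -> e \in E0 -> a \in s e -> b \in s e ->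
  a != b -> shrinking (upd pi e [set a; b]).
Proof.
move=> pi_s eE ae be nab; apply/forallP=> f; apply/implyP; rewrite updE.
case: (eqVneq f e) => [->|_] pi0; first by rewrite eE cards2 nab subUset !sub1set ae be.
by have [-> -> ->] := shrinkingP pi_s pi0.
Qed.

Lemma within_set2 R a b : is_equiv R -> (a, b) \in R -> within R [set a; b].
Proof.
move=> [Rr Rs _] Rab; apply/withinP=> x y.
by rewrite !inE => /orP[] /eqP-> /orP[] /eqP-> //; apply: Rs.
Qed.

Lemma constant_set2 l a b : l a = l b -> constant_on l [set a; b].
Proof. by move=> lab x y; rewrite !inE => /orP[] /eqP-> /orP[] /eqP->. Qed.

Lemma constant_set0 l : constant_on l set0.
Proof. by move=> x y; rewrite inE. Qed.

Lemma no_exchange m pi e a b : optimal m.+1 pi ->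
    pi e = set0 -> e \notin Lost pi m -> a \in s e -> b \in s e ->
    (a, b) \in Rel pi m -> (a, b) \notin Comp pi m ->
    (forall l, merge_closed (upd pi e [set a; b]) (Rel pi m) (Lost pi m) l -> l a = l b) ->
  False.
Proof.
elim/ltn_ind: m pi e a b => m IH pi e a b o pie eL ae be Rab nKab safe.
have [pi_f _] := o; have pi_s := forest_shrinking pi_f.
have eE := Lost_out eL.
have neq_ab : a != b.
  by apply: contraNneq nKab => ->; apply: is_equiv_refl; apply: Comp_equiv.
(* If [a] and [b] lie in different trees of [pi], using [e] enlarges [Comp pi 0]. *)
have [cab|ncab] := boolP (connect (edge_rel pi setT) a b); last first.
  pose pi1 := upd pi e [set a; b].
  have f1 : forest pi1 by apply: forest_add.
  have sub : Comp pi 0 \subset Comp pi1 0.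
    apply/subsetP=> -[x y]; rewrite !compsE !Rel0 !Lost0; apply: edge_conn_sub => f.
    rewrite !inE => /andP[fE _] fn0; rewrite fE updE.
    have /negPf-> : f != e by apply: contraNneq fn0 => ->; rewrite pie.
    by rewrite withinT.
  have eK : Comp pi1 0 = Comp pi 0 by apply: optimal_Comp o _ _ _ _.
  case/negP: ncab; have: (a, b) \in Comp pi 0.
    rewrite -eK compsE Rel0 Lost0; apply/connect1/edge_relP; exists e.
      by rewrite !inE eE withinT.
    by rewrite updE eqxx.
  by rewrite compsE; apply: edge_conn_sub => f _; rewrite inE.
have K0ab : (a, b) \in Comp pi 0.
  rewrite compsE Rel0 Lost0; apply: edge_conn_sub cab => f _ fn0; split=> //.
  by have [fE _ _] := shrinkingP pi_s fn0; rewrite !inE fE withinT.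
(* The first stage whose components separate [a] from [b] has the form [j.+1], with [j < m]. *)
pose Q k := (a, b) \notin Comp pi k.
case: (@ex_minnP Q) => [|k Qk mink]; first by exists m.
have le_km : k <= m := mink m nKab.
case: k Qk mink le_km => [|j]; first by rewrite /Q K0ab.
rewrite /Q => nKSj minj ltjm {Q}.
have Kjab : (a, b) \in Comp pi j by apply: contraT => /minj; rewrite ltnn.
move: (Kjab) (nKSj); rewrite !compsE => cj ncSj.
(* The edge [g] of the path still counts at stage [j] but not at stage [j.+1]. *)
have [g [z [w [gj gSj eg [caz cwb] sepg]]]] := separating_edge pi_f cj ncSj.
have gn0 : pi g != set0 by rewrite eg; apply/set0Pn; exists z; rewrite set21.
have neq_ge : g != e by apply: contraNneq gn0 => ->; rewrite pie.
have [gE sub_g card_g] := shrinkingP pi_s gn0.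
have zg : z \in pi g by rewrite eg set21.
have wg : w \in pi g by rewrite eg set22.
have gLj : g \notin Lost pi j by move: gj; rewrite inE => /andP[].
have wjg : within (Rel pi j) (pi g) by move: gj; rewrite inE => /andP[].
pose pi1 := upd (upd pi g set0) e [set a; b].
have pi1e : pi1 e = [set a; b] by rewrite updE eqxx.
have pi1g : pi1 g = set0 by rewrite updE (negPf neq_ge) updE eqxx.
have pi1E f : f != e -> f != g -> pi1 f = pi f.
  by move=> /negPf fe /negPf fg; rewrite updE fe updE fg.
have f1 : forest pi1.
  apply: (forest_add (forest_del g pi_f) _ eE ae be).
    by rewrite updE pie; case: (e == g).
  apply: contra sepg; apply: edge_conn_sub => f _; rewrite !inE updE andbT.
  by case: (f == g); rewrite ?eqxx.
have s1 := forest_shrinking f1.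
have L0 i : ~: E0 \subset Lost pi i by rewrite -(Lost0 E0 s pi) Lost_sub.
have Riab i : i <= m -> (a, b) \in Rel pi i by move/(Rel_sub E0 s pi)/subsetP; apply.
have eLi i : i <= m -> e \notin Lost pi i.
  by move=> le_im; apply: contra eL; apply: (subsetP (Lost_sub _ _ _ le_im)).
(* The hypothesis on [e] survives the removal of [g]: an empty part is the strongest condition, so
   closedness under [pi1] gives closedness with [g] still used. *)
have lab l K L : is_equiv K -> merge_closed pi1 K L l -> Rel pi m \subset K ->
    L \subset Lost pi m -> l a = l b.
  move=> Ke lc sK sL; apply: safe; apply: (merge_closed_transfer card_s s1 Ke lc) => // f fL.
  case: (eqVneq f e) => [->|fe]; first by constructor 1; rewrite pi1e updE eqxx.
  case: (eqVneq f g) => [->|fg].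
    by constructor 2; rewrite pi1g; split; [apply: within0|apply: constant_set0].
  by constructor 1; rewrite updE (negPf fe) pi1E.
(* Up to stage [j] the swap makes components and anticomponents at least as coarse, hence leaves
   them equal by optimality. *)
have step i : i <= j -> (forall k, k < i -> agree pi1 pi k) ->
    Rel pi1 i = Rel pi i -> Lost pi1 i = Lost pi i -> agree pi1 pi i.
  move=> le_ij tr eR eLo.
  have le_im : i <= m := leq_trans le_ij (ltnW ltjm).
  have ltim : i < m := leq_ltn_trans le_ij ltjm.
  have ltiSm : i < m.+1 := leqW ltim.
  have alive1 f : f != g -> f \in alive pi (Rel pi j) (Lost pi j) -> pi f != set0 ->
      f \in alive pi1 (Rel pi1 i) (Lost pi1 i) /\ pi1 f = pi f.
    move=> fg; rewrite !inE eR eLo => /andP[fL wf] fn0.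
    have fe : f != e by apply: contraNneq fn0 => ->; rewrite pie.
    rewrite pi1E //; split=> //; apply/andP; split.
      by apply: contra fL; apply: (subsetP (Lost_sub _ _ _ le_ij)).
    exact: within_sub (Rel_sub _ _ _ le_ij) wf.
  have up x y : connect (edge_rel pi (alive pi (Rel pi j) (Lost pi j) :\ g)) x y ->
      connect (edge_rel pi1 (alive pi1 (Rel pi1 i) (Lost pi1 i))) x y.
    by apply: edge_conn_sub => f; rewrite in_setD1 => /andP[fg]; apply: alive1.
  (* The ends of [g] remain joined by the rest of the path and the new edge of [e]. *)
  have czw : connect (edge_rel pi1 (alive pi1 (Rel pi1 i) (Lost pi1 i))) z w.
    apply: (connect_trans (y := a)); first by rewrite edge_conn_sym; apply: up.
    apply: (connect_trans (y := b)); last by rewrite edge_conn_sym; apply: up.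
    apply/connect1/edge_relP; exists e => //; rewrite !inE pi1e eLo eR eLi //=.
    by apply: within_set2; [apply: Rel_equiv|apply: Riab].
  have sub : Comp pi i \subset Comp pi1 i.
    apply/subsetP=> -[x y]; rewrite !compsE; apply: connect_sub => u v /edge_relP[f].
    case: (eqVneq f g) => [-> _|fg fi ef].
      by rewrite eg => /set2_inj[] [<- <-] //; rewrite edge_conn_sym.
    apply/connect1/edge_relP; exists f => //; last first.
      rewrite pi1E //; apply: contraPneq (set21 u v) => fe.
      by rewrite -ef fe pie inE.
    have fe : f != e.
      by apply/eqP=> fe; have:= set21 u v; rewrite -ef fe pie inE.
    by move: fi; rewrite !inE eR eLo pi1E.
  have eK : Comp pi1 i = Comp pi i by apply: optimal_Comp o f1 ltiSm tr sub.
  split=> //; apply: (optimal_Rel o f1 ltiSm tr eK).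
  rewrite !RelS eK eLo; apply/subsetP=> -[x y] /antiP[Kxy h]; apply/antiP.
  split; [exact: Kxy | move=> l lc].
  have Ke := Comp_equiv E0 s pi i.
  have l_ab : l a = l b.
    by apply: lab lc _ _ => //; [apply: Rel_sub_Comp|apply: Lost_sub].
  apply: h; apply: (merge_closed_transfer card_s s1 Ke lc) => // f fL.
  case: (eqVneq f e) => [->|fe].
    constructor 2; rewrite pi1e; split; last exact: constant_set2.
    exact: within_set2 Ke (subsetP (Rel_sub_Comp E0 s pi ltim) _ Rab).
  case: (eqVneq f g) => [->|fg].
    by constructor 2; rewrite pi1g; split; [apply: within0|apply: constant_set0].
  by constructor 1; rewrite pi1E.
have same i : i <= j -> [/\ forall k, k < i -> agree pi1 pi k,
    Rel pi1 i = Rel pi i & Lost pi1 i = Lost pi i].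
  elim: i => [|i IHi] ltij; first by split; rewrite ?Rel0 ?Lost0.
  have [tr eR eLo] := IHi (ltnW ltij).
  have tri := step i (ltnW ltij) tr eR eLo.
  have [eK eA] := tri.
  split=> //.
    by move=> k; rewrite ltnS leq_eqVlt => /predU1P[->|/tr].
  (* The discarded sets agree as well, because the two altered parts lie in one class before and
     after the swap. *)
  have ww f : within (Rel pi i.+1) (pi1 f) = within (Rel pi i.+1) (pi f).
    case: (eqVneq f e) => [->|fe].
      rewrite pi1e pie within0; apply: within_set2; first exact: Rel_equiv.
      exact: Riab (leq_trans ltij (ltnW ltjm)).
    case: (eqVneq f g) => [->|fg]; last by rewrite pi1E.
    by rewrite pi1g within0; apply/esym; apply: within_sub wjg; apply: Rel_sub.
  by rewrite !LostS eR eLo eK eA (eq_lost s (Rel pi i) (Comp pi i) (Lost pi i) ww).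
have [tr eR eLo] := same j (leqnn j).
have trj := step j (leqnn j) tr eR eLo.
have [eK eA] := trj.
have Ke := Comp_equiv E0 s pi j.
have Kzw : (z, w) \in Comp pi j.
  by rewrite compsE; apply/connect1/edge_relP; exists g.
have wSg : within (Rel pi j.+1) (pi g).
  rewrite eg; apply: within_set2; first exact: Rel_equiv.
  rewrite -eA RelS eK; apply/antiP; split=> // l /merge_closedP lc.
  by apply: (lc g); rewrite ?eLo ?(subsetP sub_g) //;
    move=> ?; rewrite ?pi1g ?inE.
have gLSj : g \in Lost pi j.+1 by move: gSj; rewrite inE wSg andbT negbK.
have : g \in lost s pi (Rel pi j) (Comp pi j) (Rel pi j.+1) (Lost pi j).
  by move: gLSj; rewrite LostS in_setU (negPf gLj).
case/lostP=> _ _ [x [y [[xg yg] Rxy nKxy cxy]]].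
have neq_xy : x != y by apply: contraNneq nKxy => ->; apply: is_equiv_refl.
have s2 : shrinking (upd pi1 g [set x; y]) by apply: shrinking_upd.
(* Induction at stage [j], with [pi1] for [pi] and the redundant [g] for [e]. *)
apply: (IH j ltjm pi1 g x y) => //; rewrite ?eLo ?eR ?eK //.
  split=> // pi' i pi'_f lti tr'; have le_ij : i <= j by [].
  have [tri eRi eLi'] := same i le_ij.
  have [eKi eAi] := step i le_ij tri eRi eLi'.
  have -> : cost pi1 i = cost pi i by rewrite !costE eKi eAi.
  case: o => _ o; apply: o pi'_f (leqW (leq_ltn_trans le_ij ltjm)) _ => k ltk.
  by have [[eK1 eA1] [eK2 eA2]] := (tr' k ltk, tri k ltk); split; [rewrite eK1|rewrite eA1].
move=> l lc; have Re := Rel_equiv E0 s pi j.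
(* [g] is discarded by stage [m], so its new part does not matter to the hypothesis on [e]. *)
have l_ab : l a = l b.
  apply: safe; apply: (merge_closed_transfer card_s s2 Re lc) => //.
  - by apply: Rel_sub; apply: ltnW.
  - by apply: Lost_sub; apply: ltnW.
  move=> f fL; constructor 1; have fg : f != g.
    apply: contraNneq fL => ->; apply: (subsetP (Lost_sub _ _ _ ltjm)) gLSj.
  rewrite updE [RHS]updE (negPf fg); case: (eqVneq f e) => [->|fe] //.
  by rewrite pi1E.
have lcK : merge_closed pi (Comp pi j) (Lost pi j) l.
  apply: (merge_closed_transfer card_s s2 Re lc) => //; first exact: Comp_sub_Rel.
  move=> f fL; case: (eqVneq f e) => [->|fe].
    constructor 2; rewrite updE eq_sym (negPf neq_ge) pi1e; split.
      by apply: within_set2 => //; apply: Riab; apply: ltnW.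
    exact: constant_set2.
  case: (eqVneq f g) => [->|fg]; last by constructor 1; rewrite updE (negPf fg) pi1E.
  (* Since [x] and [y] are in different components, the component of [pi g] contains no further
     vertex of [g]. Two distinct vertices of [g] in one component are therefore those of [pi g]. *)
  constructor 3 => u v ug vg Kuv lg.
  have cg3 := forall_inP card_s g gE.
  have Kg t t' : t \in pi g -> t' \in pi g -> (t, t') \in Comp pi j.
    by apply: (withinP (Comp pi j) (pi g)); rewrite eg; apply: within_set2.
  have alt t t' : (t, t') \in Comp pi j -> t \in pi g -> t' \in s g -> t' \notin pi g -> False.
    move=> Ktt' tg t's t'g.
    have all_t r : r \in s g -> (t, r) \in Comp pi j.
      move=> rs; case: (eqVneq r t') => [->//|nrt'].
      have := two_of_three sub_g card_g cg3 rs t's nrt'.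
      by rewrite (negPf t'g) orbF => rp; exact: Kg tg rp.
    case/negP: nKxy; apply: (is_equiv_trans Ke) (all_t _ yg).
    exact/(is_equiv_sym Ke)/all_t.
  case: (eqVneq u v) => [->//|nuv].
  case: (boolP (u \in pi g)) => up; case: (boolP (v \in pi g)) => vp.
  - exact: lg.
  - by case: (alt u v).
  - by case: (alt v u) => //; apply: (is_equiv_sym Ke).
  - by case/orP: (two_of_three sub_g card_g cg3 ug vg nuv); rewrite ?(negPf up) ?(negPf vp).
(* Labels are constant on the classes of [Rel pi j.+1], hence along the cycle that made [g]
   redundant. *)
apply: (adj_label card_s s2 Re lc) cxy.
- by move=> p q; rewrite RelS => /antiP[_]; apply.
- exact: RelS_sub.
move=> f; rewrite !inE => /andP[fg fL]; split=> //; first exact: Lost_out fL.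
rewrite updE (negPf fg); case: (eqVneq f e) => [->|fe]; last by rewrite pi1E.
rewrite pi1e => _; apply: within_set2; first exact: Rel_equiv.
exact: Riab.
Qed.

End Exchange.

(** * The last partition has no cycle of unused hyperedges *)

Lemma nat_switch (P : pred nat) n :
  P 0 -> ~~ P n -> exists i, [/\ i < n, P i & ~~ P i.+1].
Proof.
move=> P0; elim: n => [|n IHn]; first by rewrite P0.
have [Pn nPSn|nPn _] := boolP (P n); first by exists n.
by have [i [lt_in Pi nPSi]] := IHn nPn; exists i; split=> //; apply: ltnW.
Qed.

Lemma nonincreasing_stalls (f : nat -> nat) :
  (forall i, f i.+1 <= f i) -> exists2 M, M <= f 0 & f M.+1 = f M.
Proof.
move=> f_le; have [/existsP[M /eqP fM]|/pred0Pn noM] :=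
  boolP [exists M : 'I_(f 0).+1, f M.+1 == f M].
  by exists M => //; rewrite -ltnS.
have lt_f i : i <= f 0 -> f i.+1 < f i.
  move=> le_i; rewrite ltn_neqAle f_le andbT; apply/negP=> eq_f.
  by case: noM; exists (Ordinal (le_i : i < (f 0).+1)).
have le_f i : i <= (f 0).+1 -> f i + i <= f 0.
  elim: i => [|i IHi] lti; first by rewrite addn0.
  by apply: leq_trans (IHi (ltnW lti)); rewrite addnS ltn_add2r lt_f.
by have:= le_f _ (leqnn (f 0).+1); rewrite addnS ltnNge leq_addl.
Qed.

(** * Shortest paths *)

Section ShortestPath.
Variable T : finType.
Implicit Types (r : rel T) (p : seq T).

Lemma connect_shortest r x y : connect r x y -> exists p,
  [/\ path r x p, last x p = y &
      forall p', path r x p' -> last x p' = y -> size p <= size p'].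
Proof.
move=> /connectP[p0 pp0 lp0].
pose Q n := [exists p : n.-tuple T, path r x p && (last x p == y)].
have Q0 : exists n, Q n.
  by exists (size p0); apply/existsP; exists (in_tuple p0); rewrite pp0 lp0 /=.
case: (ex_minnP Q0) => n /existsP[p /andP[pp /eqP lp]] min_n.
exists p; split=> // p' pp' lp'; rewrite size_tuple; apply: min_n.
by apply/existsP; exists (in_tuple p'); rewrite pp' lp' /=.
Qed.

Lemma path_exit r r' x p : path r x p -> ~~ path r' x p -> exists p1 v p2,
  [/\ p = p1 ++ v :: p2, path r x p1, r (last x p1) v, path r v p2 &
      ~~ r' (last x p1) v].
Proof.
elim: p x => [|v p IHp] x //= /andP[rxv pv]; rewrite negb_and.
case/orP=> [nr'|nr']; first by exists [::], v, p.
have [p1 [w [p2 [-> pp1 rw pp2 nw]]]] := IHp v pv nr'.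
by exists (v :: p1), w, p2; rewrite /= rxv.
Qed.

(* A shortest path uses the links between vertices of [S] at most once. *)
Lemma shortest_single r r' (R : rel T) (S : pred T) x p1 v p2 :
    reflexive R -> symmetric R -> transitive R -> subrel r R ->
    (forall a b, r a b -> r' a b \/ S a /\ S b) ->
    (forall a b, S a -> S b -> R a b -> r a b) ->
    path r x (p1 ++ v :: p2) ->
    (forall p', path r x p' -> last x p' = last x (p1 ++ v :: p2) ->
       size (p1 ++ v :: p2) <= size p') ->
    S (last x p1) -> S v ->
  connect r' x (last x p1) /\ connect r' v (last v p2).
Proof.
move=> Rr Rs Rt rR split_r Sr; rewrite cat_path /= => /and3P[pp1 rv pp2] min_p Su Sv.
have Rlast a q : path r a q -> R a (last a q).
  elim: q a => [|b q IHq] a //= /andP[/rR Rab /IHq]; exact: Rt.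
split; apply/connectP; [exists p1 => //|exists p2 => //]; apply: contraT => nr'.
  have [q1 [b [q2 [ep1 pq1 rb pq2 nr'b]]]] := path_exit pp1 nr'.
  have [|[Sa Sb]] := split_r _ _ rb; first by rewrite (negPf nr'b).
  have Rav : R (last x q1) v.
    apply: (Rt x); first by rewrite Rs (Rlast _ _ pq1).
    exact: (Rt _ _ _ (Rlast _ _ pp1) (rR _ _ rv)).
  have := min_p (q1 ++ v :: p2); rewrite cat_path pq1 /= Sr // pp2 !last_cat /=.
  move=> /(_ isT erefl); rewrite ep1 !size_cat /= leqNgt.
  by rewrite -addnA ltn_add2l addSn ltnS leq_addl.
have [q1 [b [q2 [ep2 pq1 rb pq2 nr'b]]]] := path_exit pp2 nr'.
have [|[Sa Sb]] := split_r _ _ rb; first by rewrite (negPf nr'b).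
have Rub : R (last x p1) b.
  exact: (Rt _ _ _ (rR _ _ rv) (Rt _ _ _ (Rlast _ _ pq1) (rR _ _ rb))).
have := min_p (p1 ++ b :: q2); rewrite cat_path pp1 /= Sr // pq2.
rewrite ep2 !last_cat /= last_cat /= => /(_ isT erefl); rewrite !size_cat /= leqNgt.
by rewrite ltn_add2l ltnS size_cat /= addnS ltnS leq_addl.
Qed.

End ShortestPath.

(** * Cycles modulo the stable partition of an optimal forest *)

Section Acyclic.
Variables (V E : finType) (E0 : {set E}) (s : E -> {set V}).
Hypothesis card_s : [forall e in E0, #|s e| <= 3].
Implicit Types (pi : {ffun E -> {set V}}) (B D L : {set E}) (X : {set V}).
Implicit Types (R K A P : {set V * V}) (l : {ffun V -> V}).

Local Notation forest := (forest E0 s).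
Local Notation shrinking := (shrinking E0 s).
Local Notation Rel := (Rel E0 s).
Local Notation Lost := (Lost E0 s).
Local Notation Comp := (Comp E0 s).
Local Notation merge_closed := (merge_closed s).
Local Notation adj := (adj s).
Local Notation optimal := (optimal E0 s).

Lemma stable_exists pi : exists2 M, M <= #|{: V * V}| & Rel pi M.+1 = Rel pi M.
Proof.
have leR i : #|Rel pi i.+1| <= #|Rel pi i| by apply/subset_leq_card/RelS_sub.
have [M leM eqM] := nonincreasing_stalls leR.
exists M; first exact: leq_trans leM (max_card _).
by apply/eqP; rewrite eqEcard RelS_sub eqM leqnn.
Qed.

Lemma adj_mono pi R R' A A' B B' : R \subset R' -> A \subset A' -> B \subset B' ->
  subrel (adj pi R A B) (adj pi R' A' B').
Proof.
move=> /subsetP sR sA /subsetP sB p q /adjP[pq|[f [fB wf pf qf Rpq]]]; apply/adjP.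
  by left; apply: (subsetP sA).
by right; exists f; split; auto; apply: within_sub wf.
Qed.

Lemma connect_mono (r r' : rel V) : subrel r r' -> subrel (connect r) (connect r').
Proof. by move=> sr; apply: connect_sub => x y /sr; apply: connect1. Qed.

Lemma adj_sym pi R A B : is_equiv R -> is_equiv A -> symmetric (adj pi R A B).
Proof.
move=> [_ Rs _] [_ As _].
have imp p q : adj pi R A B p q -> adj pi R A B q p.
  case/adjP=> [pq|[f [fB wf pf qf Rpq]]]; apply/adjP; first by left; apply: As.
  by right; exists f; split; auto.
by move=> p q; apply/idP/idP; apply: imp.
Qed.

(** A cycle through [e] can be viewed from any of its hyperedges. A shortest path from [x] to [y]
    uses a bad [f] only once, so the rest of the path and [e] join the two vertices of [f] without
    [f]. *)
Lemma rotate_cycle pi R A B e x y (good : E -> rel V) :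
    is_equiv R -> is_equiv A -> A \subset R ->
    e \in B -> within A (pi e) -> x \in s e -> y \in s e -> (x, y) \in R ->
    connect (adj pi R A (B :\ e)) x y ->
  connect (fun p q => ((p, q) \in A) || [exists f in B :\ e,
     [&& within A (pi f), p \in s f, q \in s f, (p, q) \in R & good f p q]]) x y \/
  exists f p q, [/\ f \in B /\ within A (pi f), p \in s f /\ q \in s f,
     (p, q) \in R /\ (p, q) \notin A, ~~ good f p q &
     connect (adj pi R A (B :\ f)) p q].
Proof.
move=> Re Ae sAR eB we xe ye Rxy cxy; have [Rr Rs Rt] := Re.
have [p [pp lp min_p]] := connect_shortest cxy.
set r' := (fun p q => _); have [ok|nok] := boolP (path r' x p).
  by left; apply/connectP; exists p.
right; have [p1 [v [p2 [ep pp1 rv pp2 nr']]]] := path_exit pp nok.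
set u := last x p1 in rv nr'.
have nAuv : (u, v) \notin A by apply: contra nr' => Auv; rewrite /r' Auv.
case/adjP: rv => [|[f [fB wf uf vf Ruv]]]; first by rewrite (negPf nAuv).
have [fe {}fB] := setD1P fB.
exists f, u, v; split=> //.
  apply: contra nr' => gf; apply/orP; right; apply/exists_inP; exists f.
    by rewrite !inE fe.
  by apply/and5P.
have sub_r : subrel (adj pi R A (B :\ e)) (fun a b => (a, b) \in R).
  by move=> a b /adjP[/(subsetP sAR)|[h []]].
have [c1 c2] : connect (adj pi R A (B :\ e :\ f)) x u /\
    connect (adj pi R A (B :\ e :\ f)) v (last v p2).
  apply: (@shortest_single _ (adj pi R A (B :\ e)) _ (fun a b => (a, b) \in R)
     (fun a => a \in s f)) => //.
  - by move=> a b; apply/idP/idP; apply: Rs.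
  - by move=> b a c; apply: Rt.
  - move=> a b /adjP[Aab|[h [hB wh ah bh Rab]]]; first by left; apply/adjP; left.
    case: (eqVneq h f) => [hf|hf]; first by right; rewrite -hf.
    by left; apply/adjP; right; exists h; split; rewrite // !inE hf -in_setD1.
  - move=> a b af bf Rab; apply/adjP; right; exists f; split=> //.
    by rewrite !inE fe.
  - by rewrite -ep.
  - by rewrite -ep lp.
have ly : last v p2 = y by rewrite -lp ep last_cat.
have sDD : B :\ e :\ f \subset B :\ f by apply/subsetP=> h; rewrite !inE => /and3P[-> _].
have sym_c := sym_connect_sym (adj_sym pi (B :\ f) Re Ae).
have up := connect_mono (adj_mono (subxx R) (subxx A) sDD).
apply: (connect_trans (y := x)); first by rewrite sym_c; apply: up c1.
apply: (connect_trans (y := y)).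
  apply: connect1; apply/adjP; right; exists e; split=> //.
  by rewrite !inE eB eq_sym fe.
by rewrite sym_c; apply: up; rewrite -ly.
Qed.

Section Stable.
Variables (pi : {ffun E -> {set V}}) (M : nat).
Hypotheses (pi_opt : optimal M.+1 pi) (Rel_stable : Rel pi M.+1 = Rel pi M).
Let P := Rel pi M.

Let pi_f : forest pi := pi_opt.1.
Let pi_s : shrinking pi := forest_shrinking pi_f.

Lemma stable_Comp : Comp pi M = P.
Proof.
by apply/eqP; rewrite eqEsubset Comp_sub_Rel /P -{1}Rel_stable RelS_sub_Comp.
Qed.

Lemma stable_label l x y :
  merge_closed pi P (Lost pi M) l -> (x, y) \in P -> l x = l y.
Proof.
move=> lc; rewrite /P -Rel_stable RelS => /antiP[_]; apply.
by rewrite stable_Comp.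
Qed.

(** A discarded hyperedge imposes no condition at stage [M], so its part may be altered freely. *)
Lemma stable_label_upd f a b R L l x y : f \in Lost pi M ->
    shrinking (upd pi f [set a; b]) -> is_equiv R -> P \subset R -> L \subset Lost pi M ->
    merge_closed (upd pi f [set a; b]) R L l ->
  (x, y) \in P -> l x = l y.
Proof.
move=> fL s1 Re sPR sL lc; apply: stable_label.
apply: (merge_closed_transfer card_s s1 Re lc) => //.
  by rewrite -(Lost0 E0 s pi) Lost_sub.
move=> g gL; constructor 1; rewrite updE; case: eqP => // gf.
by rewrite gf fL in gL.
Qed.

Let P_equiv : is_equiv P. Proof. exact: Rel_equiv. Qed.

Let sPR i : i <= M -> P \subset Rel pi i. Proof. exact: Rel_sub. Qed.

Let adj_label_upd f a b R A L B l p q : f \notin B ->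
    shrinking (upd pi f [set a; b]) -> is_equiv R -> A \subset R ->
    (forall x y, (x, y) \in A -> l x = l y) ->
    merge_closed (upd pi f [set a; b]) R L l ->
    (forall h, h \in B -> h \in E0 /\ h \notin L) ->
  connect (adj pi R A B) p q -> l p = l q.
Proof.
move=> fB s1 Re sAR lA lc hB; apply: (adj_label card_s s1 Re lc lA sAR) => h hhB.
have [hE hL] := hB h hhB; split=> //; rewrite updE.
by case: eqP hhB => [->|//]; rewrite (negPf fB).
Qed.

(** [f] lies on two cycles: the one at stage [i] for which it was discarded, and one through [p] and
    [q] in a smaller class. The second forces equal labels on [p] and [q] even when [f] is used on
    the first, so [no_exchange] applies at stage [i]. *)
Lemma early_lost_acyclic m i f p q : i < m -> m < M ->
    f \in Lost pi i.+1 -> f \notin Lost pi i -> within P (pi f) ->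
    p \in s f -> q \in s f -> (p, q) \in Rel pi m -> (p, q) \notin P ->
    connect (adj pi (Rel pi m) P (~: Lost pi i :\ f)) p q ->
  False.
Proof.
move=> ltim ltmM fLS fL wf pf qf Rpq nPpq cpq.
have fE := Lost_out fL.
have ltiM := ltn_trans ltim ltmM.
have cf := forall_inP card_s f fE.
have Ki := Comp_equiv E0 s pi i.
have Kpq : (p, q) \in Comp pi i by apply: (subsetP (Rel_sub_Comp E0 s pi ltim)).
have neq_pq : p != q by apply: contraNneq nPpq => ->; case: P_equiv.
have : f \in lost s pi (Rel pi i) (Comp pi i) (Rel pi i.+1) (Lost pi i).
  by move: fLS; rewrite LostS in_setU (negPf fL).
case/lostP=> _ _ [x [y [[xf yf] Rxy nKxy cxy]]].
have neq_xy : x != y by apply: contraNneq nKxy => ->; case: Ki.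
(* Any third vertex in the class of p and q would put all of [f] in one class. *)
have only t : t \in s f -> (p, t) \in Comp pi i -> (t == p) || (t == q).
  move=> tf Kpt; apply: contraNT nKxy; rewrite negb_or => /andP[tp tq].
  have all_p r : r \in s f -> (p, r) \in Comp pi i.
    move=> rf; have spq : [set p; q] \subset s f by rewrite subUset !sub1set pf qf.
    have cpq2 : #|[set p; q]| = 2 by rewrite cards2 neq_pq.
    case: (eqVneq r t) => [-> //|nrt].
    have := two_of_three spq cpq2 cf rf tf nrt.
    rewrite !in_set2 (negPf tp) (negPf tq) !orbF => /orP[] /eqP-> //.
    exact: (is_equiv_refl Ki).
  apply: (is_equiv_trans Ki) (all_p _ yf).
  by apply: (is_equiv_sym Ki); apply: all_p.
(* A nonempty part contains [p] or [q] and lies in their component, so it consists of [p] and [q],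
   which [P] separates. *)
have pif0 : pi f = set0.
  apply/eqP/negPn/negP => pif; have [_ sub c2] := shrinkingP pi_s pif.
  have Kz z w : z \in pi f -> w \in pi f -> (z, w) \in Comp pi i.
    by move=> zf wf0; apply: (subsetP (Rel_sub_Comp E0 s pi ltiM)); apply: (withinP _ _ wf).
  have sub2 : pi f \subset [set p; q].
    apply/subsetP=> t tpi; rewrite !inE; apply: only; first exact: (subsetP sub).
    have := two_of_three sub c2 cf pf qf neq_pq; case/orP=> h; first exact: Kz.
    exact: (is_equiv_trans Ki) Kpq (Kz _ _ h tpi).
  have /eqP e2 : pi f == [set p; q] by rewrite eqEcard sub2 c2 cards2 neq_pq.
  by case/negP: nPpq; apply: (withinP _ _ wf); rewrite e2 ?set21 ?set22.
have s1 : shrinking (upd pi f [set x; y]) by apply: shrinking_upd.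
have fLM : f \in Lost pi M by apply: (subsetP (Lost_sub E0 s pi ltiM)).
have outB h : h \in ~: Lost pi i :\ f -> h \in E0 /\ h \notin Lost pi i.
  by rewrite !inE => /andP[_ hL]; split=> //; apply: Lost_out hL.
have nfB : f \notin ~: Lost pi i :\ f by rewrite !inE eqxx.
have optS : optimal i.+1 pi by apply: optimal_le pi_opt; apply: ltnW.
apply: (no_exchange card_s optS pif0 fL xf yf Rxy nKxy) => l lc.
have Re := Rel_equiv E0 s pi i.
have lP u v : (u, v) \in P -> l u = l v.
  apply: (stable_label_upd fLM s1 Re (sPR (ltnW ltiM)) _ lc).
  exact: Lost_sub (ltnW ltiM).
have lpq : l p = l q.
  apply: (adj_label_upd nfB s1 Re (sPR (ltnW ltiM)) lP lc outB).
  by apply: connect_mono cpq; apply: adj_mono => //; apply: Rel_sub (ltnW ltim).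
apply: (adj_label_upd nfB s1 Re (RelS_sub _ _ _ _) _ lc outB cxy) => u v.
rewrite RelS => /antiP[_]; apply.
apply: (merge_closed_transfer card_s s1 Re lc) => //.
- exact: Comp_sub_Rel.
- by rewrite -(Lost0 E0 s pi) Lost_sub.
move=> h hL; case: (eqVneq h f) => [->|hf]; last by constructor 1; rewrite updE (negPf hf).
(* Distinct vertices of [f] in one component can only be [p] and [q], whose labels agree. *)
constructor 3 => a b af bf Kab _.
case: (eqVneq a b) => [->//|nab].
have spq : [set p; q] \subset s f by rewrite subUset !sub1set pf qf.
have cpq2 : #|[set p; q]| = 2 by rewrite cards2 neq_pq.
have /orP ab2 := two_of_three spq cpq2 cf af bf nab.
have Kp t : t \in [set p; q] -> (p, t) \in Comp pi i.
  by rewrite in_set2 => /orP[] /eqP-> //; apply: (is_equiv_refl Ki).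
have [pa pb] : (p, a) \in Comp pi i /\ (p, b) \in Comp pi i.
  case: ab2 => /Kp Kpt; split; rewrite ?Kpt //; first exact: (is_equiv_trans Ki) Kpt Kab.
  exact: (is_equiv_trans Ki) Kpt (is_equiv_sym Ki Kab).
by case/orP: (only a af pa) => /eqP->; case/orP: (only b bf pb) => /eqP->.
Qed.

(** The cycle makes [f] redundant at stage [m]. If [f] were used, the ends of its edge would be
    joined inside a class of [P] by edges that are not discarded, against the forest; if not,
    [no_exchange] applies at stage [m]. *)
Lemma crossing_acyclic m f p q : m < M -> f \notin Lost pi m -> within P (pi f) ->
    p \in s f -> q \in s f -> (p, q) \in Rel pi m -> (p, q) \notin Comp pi m ->
    connect (adj pi (Rel pi m) P (~: Lost pi m :\ f)) p q ->
  False.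
Proof.
move=> ltmM fL wf pf qf Rpq nKpq cpq.
have fE := Lost_out fL.
have neq_pq : p != q.
  by apply: contraNneq nKpq => ->; apply: is_equiv_refl; apply: Comp_equiv.
have fLS : f \in Lost pi m.+1.
  rewrite LostS in_setU; apply/orP; right; apply/lostP; split=> //.
    by apply: within_sub wf; apply: sPR.
  exists p, q; split=> //; apply: connect_mono cpq; apply: adj_mono => //.
  exact: sPR.
have fLM : f \in Lost pi M by apply: (subsetP (Lost_sub E0 s pi ltmM)).
have [pif0|pif] := eqVneq (pi f) set0; last first.
  have [_ _ /eqP/cards2P[z [w [nzw ef]]]] := shrinkingP pi_s pif.
  case/negP: (forest_bridge pi_f ef).
  have : (z, w) \in P by apply: (withinP _ _ wf); rewrite ef ?set21 ?set22.
  rewrite -stable_Comp compsE; apply: edge_conn_sub => h; rewrite !inE andbT.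
  by case/andP=> hL _ _; split=> //; apply: contraNneq hL => ->.
have s1 : shrinking (upd pi f [set p; q]) by apply: shrinking_upd.
have optS : optimal m.+1 pi by apply: optimal_le pi_opt; apply: ltnW.
apply: (no_exchange card_s optS pif0 fL pf qf Rpq nKpq) => l lc.
have Re := Rel_equiv E0 s pi m.
have lP u v : (u, v) \in P -> l u = l v.
  apply: (stable_label_upd fLM s1 Re (sPR (ltnW ltmM)) _ lc).
  exact: Lost_sub (ltnW ltmM).
apply: (adj_label_upd _ s1 Re (sPR (ltnW ltmM)) lP lc _ cpq); first by rewrite !inE eqxx.
by move=> h; rewrite !inE => /andP[_ hL]; split=> //; apply: Lost_out hL.
Qed.

(** The index [m] bounds the class in which a cycle lives, and [i] tells which hyperedges may occur
    on it. *)
Let bad m i : bool := [exists e in ~: Lost pi i, exists x in s e, exists y in s e,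
  [&& within P (pi e), (x, y) \in Rel pi m, (x, y) \notin P &
      connect (adj pi (Rel pi m) P (~: Lost pi i :\ e)) x y]].

Let badP m i : reflect (exists e x y, [/\ e \notin Lost pi i /\ within P (pi e),
    x \in s e /\ y \in s e, (x, y) \in Rel pi m, (x, y) \notin P &
    connect (adj pi (Rel pi m) P (~: Lost pi i :\ e)) x y]) (bad m i).
Proof.
apply: (iffP exists_inP) => [[e eL]|[e [x [y [[eL we] [xe ye] Rxy nP c]]]]].
  case/exists_inP=> x xe /exists_inP[y ye /and4P[we Rxy nP c]].
  by exists e, x, y; rewrite in_setC in eL.
exists e; first by rewrite in_setC.
by apply/exists_inP; exists x => //; apply/exists_inP; exists y => //; apply/and4P.
Qed.

(** Take [m] such that cycles exist inside classes of stage [m] but not of stage [m.+1]. If each of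
    them has a hyperedge discarded by stage [m], [early_lost_acyclic] applies to one. Otherwise some
    cycle without such hyperedges leaves a component, against [crossing_acyclic]. *)
Lemma stable_acyclic e x y : e \in E0 -> within P (pi e) ->
    x \in s e -> y \in s e -> (x, y) \notin P ->
  ~~ connect (adj pi setT P (E0 :\ e)) x y.
Proof.
move=> eE we xe ye nPxy; apply/negP=> cxy.
have bad0 : bad 0 0.
  by apply/badP; exists e, x, y; rewrite Rel0 Lost0 setCK !inE eE.
have nbadM : ~~ bad M 0 by apply/badP=> -[? [? [? [_ _ h]]]]; rewrite -/P h.
have [m [ltmM {}bad0 nbadS]] := nat_switch (P := fun m => bad m 0) bad0 nbadM.
have leRm := Rel_equiv E0 s pi m; have sPm := sPR (ltnW ltmM).
have [badm|nbadm] := boolP (bad m m); last first.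
  have [i [ltim /badP[f [p [q [[fL wf] [pf qf] Rpq nPpq cpq]]]] nbadi]] :=
    nat_switch (P := bad m) bad0 nbadm.
  have [fLS|fLS] := boolP (f \in Lost pi i.+1).
    exact: (early_lost_acyclic ltim ltmM fLS fL wf pf qf Rpq nPpq cpq).
  have fB : f \in ~: Lost pi i by rewrite in_setC.
  have [c|[h [u [v [[hB wh] [uh vh] [Ruv nPuv] hLS c]]]]] := rotate_cycle
    (fun h _ _ => h \notin Lost pi i.+1) leRm P_equiv sPm fB wf pf qf Rpq cpq.
    case/badP: nbadi; exists f, p, q; split=> //; apply: connect_mono c => u v.
    case/orP=> [Puv|/exists_inP[h hB /and5P[wh uh vh Ruv hL]]]; apply/adjP; first by left.
    by right; exists h; split=> //; move: hB; rewrite !inE hL => /andP[->].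
  rewrite negbK in hLS; rewrite in_setC in hB.
  exact: (early_lost_acyclic ltim ltmM hLS hB wh uh vh Ruv nPuv c).
have [f [p [q [[fL wf] [pf qf] Rpq nPpq cpq]]]] := badP _ _ badm.
have [Kpq|Kpq] := boolP ((p, q) \in Comp pi m); last first.
  exact: (crossing_acyclic ltmM fL wf pf qf Rpq Kpq cpq).
have fB : f \in ~: Lost pi m by rewrite in_setC.
(* The anticomponent step does not cut such a hyperedge inside a component, so a cycle that stays
   inside components persists at stage [m.+1]. *)
have RS h u v : h \notin Lost pi m -> within P (pi h) -> u \in s h -> v \in s h ->
    (u, v) \in Comp pi m -> (u, v) \in Rel pi m.+1.
  move=> hL wh uh vh Kuv; rewrite RelS; apply/antiP; split=> // l lc.
  apply: (merge_closed_free card_s pi_s (Comp_equiv E0 s pi m) lc hL (Lost_out hL)) => //.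
    by apply: within_sub wh; apply: Rel_sub_Comp.
  move=> z w zh wh0; have : (z, w) \in Rel pi m.+1.
    by apply: (subsetP (sPR ltmM)); apply: (withinP _ _ wh).
  by rewrite RelS => /antiP[_]; apply.
have [c|[h [u [v [[hB wh] [uh vh] [Ruv nPuv] Kuv c]]]]] := rotate_cycle
  (fun _ u v => (u, v) \in Comp pi m) leRm P_equiv sPm fB wf pf qf Rpq cpq.
  case/badP: nbadS; exists f, p, q; split=> //; last first.
  - apply: connect_mono c => u v.
    case/orP=> [Puv|/exists_inP[h hB /and5P[wh uh vh Ruv Kuv]]]; apply/adjP; first by left.
    have [hf hL] := setD1P hB; rewrite in_setC in hL.
    right; exists h; split=> //; last exact: (RS h).
    by rewrite Lost0 setCK in_setD1 hf (Lost_out hL).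
  - exact: (RS f).
  - by split=> //; rewrite Lost0 in_setC negbK (Lost_out fL).
rewrite in_setC in hB.
exact: (crossing_acyclic ltmM hB wh uh vh Ruv Kuv c).
Qed.

End Stable.

End Acyclic.

(** * Counting degrees in the last partition *)

Section ForestCount.
Variables (V E : finType) (s : E -> {set V}).
Implicit Types (D : {set E}) (Y S : {set V}) (l : V -> V).

Definition link l D : rel V := fun p q =>
  (l p == l q) || [exists f in D, (p \in s f) && (q \in s f)].

Lemma leq_card_labels l l' S :
  {in S &, forall x y, l' x = l' y -> l x = l y} -> #|l @: S| <= #|l' @: S|.
Proof.
move=> ll'; pose g z := l (odflt z [pick x in S | l' x == z]).
apply: leq_trans (leq_imset_card g _); apply/subset_leq_card/subsetP=> _ /imsetP[x xS ->].
rewrite -imset_comp; apply/imsetP; exists x => //=; rewrite /g.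
case: pickP => [y /andP[yS /eqP l'y]|/(_ x)]; last by rewrite xS eqxx.
exact: ll'.
Qed.

(* Merging the labels on [s f], one [f] at a time, loses [#|l @: s f| - 1] labels
   each time if the hyperedges form no cycle. *)
Lemma forest_count l D Y :
    (forall f, f \in D -> s f != set0 /\ s f \subset Y) ->
    (forall f x y, f \in D -> x \in s f -> y \in s f ->
       connect (link l (D :\ f)) x y -> l x = l y) ->
  exists2 l' : V -> V, forall x y, l' x = l' y -> connect (link l D) x y &
    \sum_(f in D) #|l @: s f|.-1 + #|l' @: Y| <= #|l @: Y|.
Proof.
have [n] := ubnP #|D|; elim: n D => // n IHn D leDn sD acyc.
have [->|[f fD]] := set_0Vmem D.
  exists l; last by rewrite big_set0.
  by move=> x y lxy; apply: connect1; rewrite /link lxy eqxx.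
have subl D1 D2 : D1 \subset D2 -> forall x y, connect (link l D1) x y -> connect (link l D2) x y.
  move=> sub; apply: connect_sub => x y /orP[lxy|/exists_inP[g gD xyg]].
    by apply: connect1; rewrite /link lxy.
  apply/connect1/orP; right; apply/exists_inP; exists g => //; exact: (subsetP sub).
have leD1n : #|D :\ f| < n by move: leDn; rewrite (cardsD1 f D) fD.
have [||l1 l1c cnt] := IHn (D :\ f) leD1n.
- by move=> g /setD1P[_ /sD].
- move=> g x y /setD1P[gf gD] xg yg c; apply: (acyc g) => //; apply: subl c.
  by apply: setSD; apply: subsetDl.
have [/set0Pn[x0 x0f] sfY] := sD f fD.
pose l' x := if l1 x \in l1 @: s f then l1 x0 else l1 x.
have up := subl _ _ (subsetDl D [set f]).
have link_f u v : u \in s f -> v \in s f -> connect (link l D) u v.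
  move=> uf vf; apply/connect1/orP; right.
  by apply/exists_inP; exists f => //; rewrite uf vf.
have sub_img : l1 @: s f \subset l1 @: Y by apply: imsetS.
exists l' => [x y|].
  rewrite /l'; case: ifP => [/imsetP[u uf xu]|xn]; case: ifP => [/imsetP[v vf yv]|yn].
  - move=> _; apply: connect_trans (up _ _ (l1c _ _ xu)) _.
    apply: connect_trans (link_f _ _ uf vf) _; apply: up; apply: l1c; exact/esym.
  - by move=> e0; rewrite -e0 imset_f in yn.
  - by move=> e0; rewrite e0 imset_f in xn.
  - by move/l1c/up.
rewrite (big_setD1 f) //= -addnA addnCA; apply: leq_trans cnt; rewrite leq_add2l.
(* By acyclicity the other hyperedges have not merged different labels on [s f]. *)
have le1 : #|l @: s f| <= #|l1 @: s f|.
  by apply: leq_card_labels => x y xf yf /l1c; apply: acyc.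
have le2 : #|l' @: Y| <= (#|l1 @: Y :\: l1 @: s f|).+1.
  rewrite -add1n -(cards1 (l1 x0)); apply: leq_trans (leq_card_setU _ _).
  apply/subset_leq_card/subsetP=> _ /imsetP[x xY ->]; rewrite /l' !inE.
  by case: ifP => [_|xn]; rewrite ?eqxx // xn imset_f ?orbT.
have gt0 : 0 < #|l @: s f| by apply/card_gt0P; exists (l x0); rewrite imset_f.
rewrite -ltnS -addSn prednK // addnC.
apply: leq_trans (leq_add le2 le1) _; rewrite addSn ltnS addnC.
by rewrite -(cardsID (l1 @: s f) (l1 @: Y)) (setIidPr sub_img).
Qed.

End ForestCount.

(** * Edge-cuts and the degrees of the classes *)

Section Counting.
Variables (V E : finType) (H : hypergraph V E).
Hypotheses (hH : hypergraph3 H) (hconn : edge_connected 4 H).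
Hypothesis hcut : forall (F : {set E}) (e : E),
  edge_cut H F -> #|F| = 4 -> e \in F -> #|ends H e| <> 3.

(** The hyperedges leaving [X] contain an edge-cut, of size at least 4. If there are only 4, they
    are that edge-cut and include no 3-hyperedge. *)
Lemma cut_size (X : {set V}) (F : {set E}) :
    X \subset verts H -> X != set0 -> X != verts H ->
    F = [set f in edges H | meets (ends H f) X && meets (ends H f) (verts H :\: X)] ->
  4 + [exists f in F, #|ends H f| == 3] <= #|F|.
Proof.
move=> sX X0 XV defF.
have pF : (F \subset edges H) && ~~ connected (del_edges H F).
  apply/andP; split; first by apply/subsetP=> f; rewrite defF inE => /andP[].
  apply/negP=> /forallP/(_ X)/implyP; rewrite /= sX X0 XV => /(_ isT).
  by case/exists_inP=> f; rewrite defF !inE => /andP[nF fE] m; rewrite fE m in nF.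
have [F0 F0cut sF0] := @minset_exists _
  (fun F' => (F' \subset edges H) && ~~ connected (del_edges H F')) F pF.
have le4 : 4 <= #|F0| := hconn.2 F0 F0cut.
have leF := leq_trans le4 (subset_leq_card sF0).
case: exists_inP => [[f fF /eqP c3]|_]; last by rewrite addn0.
rewrite addn1 ltn_neqAle leF andbT; apply/eqP=> e4.
have /eqP eF : F0 == F by rewrite eqEcard sF0 -e4.
by apply: (hcut F0cut _ _ c3); rewrite eF.
Qed.

Variables (pi : {ffun E -> {set V}}) (P : {set V * V}).
Hypotheses (pi_f : forest (edges H) (ends H) pi) (Pe : is_equiv P).
Hypothesis P_conn : forall x y, (x, y) \in P ->
  connect (edge_rel pi [set f | within P (pi f)]) x y.
Hypothesis P_acyc : forall e x y, e \in edges H -> within P (pi e) ->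
  x \in ends H e -> y \in ends H e -> (x, y) \notin P ->
  ~~ connect (adj (ends H) pi setT P (edges H :\ e)) x y.

Let lbl x : V := odflt x [pick y | (x, y) \in P].

Let lblP x y : reflect (lbl x = lbl y) ((x, y) \in P).
Proof.
have [Pr Ps Pt] := Pe.
have lbl_in z : (z, lbl z) \in P.
  by rewrite /lbl; case: pickP => //= /(_ z); rewrite Pr.
apply: (iffP idP) => [Pxy|exy].
  rewrite /lbl (@eq_pick _ _ (fun z => (y, z) \in P)).
    by case: pickP => // /(_ y); rewrite Pr.
  by move=> z; apply/idP/idP; [apply: Pt (Ps _ _ Pxy)|apply: Pt Pxy].
by apply: Pt (lbl_in x) _; rewrite exy; apply: Ps.
Qed.

Let withinE X : within P X = (#|lbl @: X| <= 1).
Proof.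
apply/withinP/card_le1_eqP => [h _ _ /imsetP[x xX ->] /imsetP[y yX ->]|h x y xX yX].
  by apply/lblP; apply: h.
by apply/lblP; apply: h; apply: imset_f.
Qed.

(** The hyperedges that cross classes split into those used across classes ([U]) and the rest ([N]).
    [L] stands for the set of classes. *)
Let C := [set f in edges H | ~~ within P (ends H f)].
Let U := [set f in edges H | ~~ within P (pi f)].
Let N := [set f in C | within P (pi f)].
Let delta a := [set f in C | a \in lbl @: ends H f].
Let L := lbl @: verts H.
Let W := [set a in L | [exists f in delta a, #|ends H f| == 3]].
Let U3 := [set f in U | #|ends H f| == 3].

Let ends_sub f : f \in edges H -> ends H f \subset verts H.
Proof. by case/hH. Qed.

Let pi_sub f : f \in U -> [/\ f \in edges H, pi f \subset ends H f & #|pi f| = 2].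
Proof.
rewrite inE => /andP[fE nw]; apply: (shrinkingP (forest_shrinking pi_f)).
by apply: contraNneq nw => ->; apply: within0.
Qed.

Let U_sub_C f : f \in U -> f \in C.
Proof.
move=> fU; have [fE sub _] := pi_sub fU; move: fU; rewrite !inE fE /= .
apply: contra => /withinP h; apply/withinP=> x y xf yf.
by apply: h; apply: (subsetP sub).
Qed.

(** [P_acyc] lets [forest_count] apply to [N]; the strict inequality comes from a label that is left
    at the end. *)
Let count_N : verts H != set0 -> (\sum_(f in N) #|lbl @: ends H f|.-1) < #|L|.
Proof.
case/set0Pn=> v vV.
have [f|f x y|l' _ cnt] := @forest_count _ _ (ends H) lbl N (verts H).
- rewrite !inE -andbA => /and3P[fE nw _]; split; last exact: ends_sub.
  by apply: contraNneq nw => ->; apply: within0.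
- rewrite !inE -andbA => /and3P[fE nw wf] xf yf c; apply/lblP; apply: contraT => nP.
  case/negP: (P_acyc fE wf xf yf nP); apply: connect_sub c => p q.
  case/orP=> [/eqP/lblP Ppq|/exists_inP[g]].
    by apply/connect1/adjP; left.
  rewrite !inE -!andbA => /and4P[gf gE _ wg] /andP[pg qg].
  by apply/connect1/adjP; right; exists g; rewrite !inE gf gE.
apply: leq_trans cnt; rewrite -addn1 leq_add2l.
by apply/card_gt0P; exists (l' v); apply: imset_f.
Qed.

(** The classes of [P] are connected by edges of [pi] inside them, so a cycle on the contracted
    classes lifts to a walk of [pi] around one of its edges. *)
Let count_sub_U (D : {set E}) (Y : {set V}) : D \subset U ->
    (forall f, f \in D -> pi f \subset Y) -> Y != set0 -> #|D| < #|lbl @: Y|.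
Proof.
move=> /subsetP sDU sDY /set0Pn[v vY].
have two f : f \in U -> #|lbl @: pi f| = 2.
  move=> fU; have [_ _ c2] := pi_sub fU; apply/eqP.
  rewrite eqn_leq -{1}c2 leq_imset_card /= ltnNge -withinE.
  by move: fU; rewrite inE => /andP[].
have [f fD|f x y fD xf yf c|l' _ cnt] := @forest_count _ _ pi lbl D Y.
- split; last exact: sDY.
  have [_ _ c2] := pi_sub (sDU f fD); by rewrite -card_gt0 c2.
- apply/lblP; apply: contraT => nP.
  have fU := sDU f fD; have [fE sub c2] := pi_sub fU.
  have nxy : x != y by apply: contraNneq nP => ->; apply: (is_equiv_refl Pe).
  have ef : pi f = [set x; y].
    apply/esym/eqP; rewrite eqEcard subUset !sub1set xf yf /=.
    by rewrite c2 cards2 nxy.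
  case/negP: (forest_bridge pi_f ef); apply: connect_sub c => p q.
  case/orP=> [/eqP/lblP/P_conn|/exists_inP[g /setD1P[gf /sDU gU] /andP[pg qg]]].
    apply: edge_conn_sub => g; rewrite inE => wg _; split=> //.
    rewrite !inE andbT; apply: contraTneq wg => ->.
    by move: fU; rewrite inE => /andP[].
  have [_ _ cg2] := pi_sub gU; case: (eqVneq p q) => [->//|npq].
  apply/connect1/edge_relP; exists g; first by rewrite !inE gf.
  by apply/esym/eqP; rewrite eqEcard subUset !sub1set pg qg cg2 cards2 npq.
rewrite (eq_bigr (fun=> 1)) in cnt; last by move=> f /sDU/two->.
rewrite sum1_card in cnt; apply: leq_trans cnt; rewrite -addn1 leq_add2l.
by apply/card_gt0P; exists (l' v); apply: imset_f.
Qed.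

(** The parts of these 3-hyperedges only touch classes of [W], on which they form a forest. *)
Let count_U3 : #|U3| <= #|W|.
Proof.
have [->|[f0 f0U]] := set_0Vmem U3; first by rewrite cards0.
pose Y := [set x in verts H | lbl x \in W].
have sub f : f \in U3 -> pi f \subset Y.
  rewrite inE => /andP[fU c3]; have [fE sub _] := pi_sub fU.
  have fC := U_sub_C fU.
  apply/subsetP=> x xf; have xe := subsetP sub _ xf.
  have xV := subsetP (ends_sub fE) _ xe.
  rewrite inE xV inE imset_f //=; apply/exists_inP; exists f => //.
  by rewrite inE fC imset_f.
have Y0 : Y != set0.
  have := sub f0 f0U; move: f0U; rewrite inE => /andP[/pi_sub[_ _ c2] _] sY.
  by rewrite -card_gt0; apply: leq_trans (subset_leq_card sY); rewrite c2.
apply: leq_trans (ltnW (count_sub_U _ sub Y0)) _.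
  by apply/subsetP=> f; rewrite inE => /andP[].
by apply/subset_leq_card/subsetP=> _ /imsetP[x /setIdP[_ xW] ->].
Qed.

Let degree a : 1 < #|L| -> a \in L -> 4 + (a \in W) <= #|delta a|.
Proof.
move=> gt1 aL; pose X := [set x in verts H | lbl x == a].
have sX : X \subset verts H by apply/subsetP=> x; rewrite inE => /andP[].
have X0 : X != set0.
  by case/imsetP: aL => x xV ax; apply/set0Pn; exists x; rewrite inE xV ax eqxx.
have XV : X != verts H.
  apply: contraTneq gt1 => eX; rewrite -leqNgt; apply/card_le1_eqP.
  have lX x : x \in verts H -> lbl x = a by rewrite -eX inE => /andP[_ /eqP].
  by move=> _ _ /imsetP[x /lX-> ->] /imsetP[y /lX-> ->].
suff defD : delta a =
    [set f in edges H | meets (ends H f) X && meets (ends H f) (verts H :\: X)].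
  by have := cut_size sX X0 XV defD; rewrite inE aL.
apply/setP=> f; rewrite !inE; case fE: (f \in edges H) => //=.
have sub := subsetP (ends_sub fE).
apply/andP/andP=> -[]; last first.
  case/set0Pn=> x; rewrite !inE => /and3P[xf xV /eqP lx].
  case/set0Pn=> y; rewrite !inE => /and3P[yf nyX yV].
  split; last by rewrite -lx imset_f.
  apply: contraNN nyX => /withinP/(_ x y xf yf)/lblP <-.
  by rewrite yV lx eqxx.
move=> nw /imsetP[x xf ax]; split.
  by apply/set0Pn; exists x; rewrite !inE xf (sub x xf) -ax eqxx.
apply: contraNT nw; rewrite negbK => /eqP m0; apply/withinP.
have la y : y \in ends H f -> lbl y = a.
  move=> yf; apply/eqP; apply: contraT => nya.
  have: y \in ends H f :&: (verts H :\: X) by rewrite !inE yf (sub y yf) nya.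
  by rewrite m0 inE.
by move=> y z yf zf; apply/lblP; rewrite !la.
Qed.

Lemma one_class : {in verts H &, forall x y, (x, y) \in P}.
Proof.
apply/(withinP P (verts H)); rewrite withinE leqNgt; apply/negP=> gt1.
have V0 : verts H != set0.
  by apply: contraTneq gt1 => V0; rewrite V0 imset0 cards0.
have cN := count_N V0.
have cU : #|U| < #|L|.
  apply: count_sub_U => // f fU; have [fE sub _] := pi_sub fU.
  exact: subset_trans sub (ends_sub fE).
have lower : 4 * #|L| + #|W| <= \sum_(a in L) #|delta a|.
  have -> : 4 * #|L| + #|W| = \sum_(a in L) (4 + (a \in W)).
    rewrite big_split /= sum_nat_const mulnC; congr (_ + _).
    rewrite -big_mkcondr /= -sum1_card; apply: eq_bigl => a.
    by rewrite inE andbA andbb.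
  by apply: leq_sum => a; apply: degree.
have swap : \sum_(a in L) #|delta a| = \sum_(f in C) #|lbl @: ends H f|.
  pose T a f := (f \in C) && (a \in lbl @: ends H f).
  rewrite (eq_bigr (fun a => \sum_(f | T a f) 1)); last first.
    by move=> a _; rewrite -sum1_card; apply: eq_bigl => f; rewrite inE.
  rewrite (exchange_big_dep (mem C)) /=; last by move=> a f _ /andP[].
  apply: eq_bigr => f fC; rewrite -sum1_card; apply: eq_bigl => a.
  rewrite /T fC /=; apply: andb_idl; apply: (subsetP (imsetS _ (ends_sub _))).
  by move: fC; rewrite inE => /andP[].
have upper : \sum_(f in C) #|lbl @: ends H f| <=
    2 * #|U| + #|U3| + 2 * \sum_(f in N) #|lbl @: ends H f|.-1.
  rewrite (bigID (fun f => within P (pi f))) /= addnC; apply: leq_add.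
    have -> : 2 * #|U| + #|U3| = \sum_(f in U) (2 + (#|ends H f| == 3)).
      rewrite big_split /= sum_nat_const mulnC; congr (_ + _).
      by rewrite -big_mkcondr /= -sum1_card; apply: eq_bigl => f; rewrite !inE.
    rewrite (eq_bigl (fun f => f \in U)); last first.
      move=> f; apply/andP/idP=> [[fC nw]|fU].
        by rewrite inE nw andbT; move: fC; rewrite inE => /andP[].
      by split; [apply: U_sub_C|move: fU; rewrite inE => /andP[]].
    apply: leq_sum => f /pi_sub[fE _ _]; apply: leq_trans (leq_imset_card _ _) _.
    by case: (hH fE) => _ [] ->.
  rewrite big_distrr /= (eq_bigl (fun f => f \in N)); last by move=> f; rewrite !inE.
  apply: leq_sum => f; rewrite !inE -andbA => /and3P[_ + _].
  (* A crossing hyperedge meets at least 2 classes, and k is at most 2(k - 1) for k at least 2. *)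
  rewrite withinE -ltnNge; case: #|_| => [|[|k]] //= _.
  by rewrite mul2n -addnn addnS ltnS leq_addr.
(* With n classes the bounds read 4n + w <= 2(n - 1) + w + 2(n - 1), where w is [#|W|]. *)
have := leq_trans lower _; move/(_ _ (leq_trans (eq_leq swap) upper)).
apply/negP; rewrite -ltnNge.
apply: (@leq_ltn_trans (2 * #|U| + #|W| + 2 * \sum_(f in N) #|lbl @: ends H f|.-1)).
  by rewrite leq_add2r leq_add2l count_U3.
rewrite addnAC ltn_add2r -mulnDr (_ : 4 = 2 * 2) // -mulnA ltn_mul2l /=.
by rewrite mul2n -addnn -addSn leq_add // ltnW.
Qed.

End Counting.

(** * Tight complements from labelings *)

Section Tight.
Variables (V E : finType) (pi : E -> {set V}).
Implicit Types (G : hypergraph V E) (X Y : {set V}).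

Lemma eq_connected G G' : verts G' = verts G -> edges G' = edges G ->
  {in edges G, ends G' =1 ends G} -> connected G -> connected G'.
Proof.
move=> eV eE eN /forallP cG; apply/forallP=> X; rewrite eV; apply/implyP=> /(implyP (cG X)).
by case/exists_inP=> e eG m; apply/exists_inP; exists e; rewrite ?eE ?eN.
Qed.

Lemma eq_used G G' : edges G' = edges G -> used G' pi = used G pi.
Proof. by move=> eE; rewrite /used eE. Qed.

(** Needed because a section of a section is a section only up to pointwise equality of [ends]. *)
Lemma eq_tight G G' : verts G' = verts G -> edges G' = edges G ->
  {in edges G, ends G' =1 ends G} -> tight_complement pi G -> tight_complement pi G'.
Proof.
move=> + + + tG; elim: tG G' => {G} [G cG|G X1 X2 eX dis X10 X20 t1 IH1 t2 IH2 [e [eu es1 m]]] G' eV eE eN.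
  apply: TightConnected; apply: eq_connected cG; rewrite /= ?eE ?(eq_used eE) //.
  by move=> e /setDP[eG _]; apply: eN.
have eS X : edges (section G' pi X) = edges (section G pi X).
  apply/setP=> f; rewrite !inE eE; case fG: (f \in edges G) => //=.
  by rewrite eN.
have eNS X : {in edges (section G pi X), ends (section G' pi X) =1 ends (section G pi X)}.
  by move=> f; rewrite inE => /andP[fG _] /=; rewrite eN.
have eG : e \in edges G by move: eu; rewrite inE => /andP[].
apply: (TightSplit (X1 := X1) (X2 := X2)) => //; rewrite ?eV //.
- exact: IH1.
- exact: IH2.
- by exists e; rewrite (eq_used eE) eN.
Qed.

Variable H : hypergraph V E.

Lemma tight_subsection X Y : X \subset Y ->
  tight_complement pi (section H pi X) ->
  tight_complement pi (section (section H pi Y) pi X).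
Proof.
move=> sXY; have sI f : ends H f :&: Y :&: X = ends H f :&: X.
  by rewrite -setIA (setIidPr sXY).
apply: eq_tight => [//| |f _]; last exact: sI.
apply/setP=> f; rewrite !inE sI; case: (f \in edges H) => //=.
case c2: (2 <= #|ends H f :&: X|); rewrite ?andbF //=.
case sX: (pi f \subset X); rewrite ?andbF // (subset_trans sX sXY) !andbT.
by apply: leq_trans c2 (subset_leq_card _); apply: setIS.
Qed.

Lemma tight_union X Y e : X != set0 -> Y != set0 -> [disjoint X & Y] ->
    tight_complement pi (section H pi X) -> tight_complement pi (section H pi Y) ->
    e \in edges H -> #|pi e| = 2 -> pi e \subset ends H e -> pi e \subset X ->
    meets (ends H e) Y ->
  tight_complement pi (section H pi (X :|: Y)).
Proof.
move=> X0 Y0 dis tX tY eE c2 sub sX m; apply: (TightSplit (X1 := X) (X2 := Y)) => //.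
- exact: tight_subsection (subsetUl _ _) tX.
- exact: tight_subsection (subsetUr _ _) tY.
have sXY : pi e \subset X :|: Y := subset_trans sX (subsetUl _ _).
exists e; split=> //; last by rewrite /meets /= -setIA (setIidPr (subsetUr _ _)).
rewrite !inE eE sXY -card_gt0 c2 !andbT /= -c2.
by apply: subset_leq_card; rewrite subsetI sub.
Qed.

End Tight.

(** * The quasitree and its tight complement, read off from the forest *)

Section Reading.
Variables (V E : finType) (H : hypergraph V E) (pi : {ffun E -> {set V}}).
Hypotheses (hH : hypergraph3 H) (pi_f : forest (edges H) (ends H) pi).
Implicit Types (X Y : {set V}) (l : {ffun V -> V}).

Let pi_s := forest_shrinking pi_f.

Let ends_sub f : f \in edges H -> ends H f \subset verts H.
Proof. by case/hH. Qed.

Lemma quasigraph_forest : quasigraph H pi.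
Proof.
move=> e eE; have [->|pi0] := eqVneq (pi e) set0; first by rewrite sub0set; split; [|left].
by have [_ ? ?] := shrinkingP pi_s pi0; split; [|right].
Qed.

Lemma walk_connected es v vs w :
    all2 (fun e (p : V * V) => ends (star H pi) e == [set p.1; p.2]) es
      (zip (v :: vs) (rcons vs w)) ->
  connect (edge_rel pi [set e in es]) v w.
Proof.
elim: vs v es => [|u vs IH] v [|e es] //=; case/andP=> /eqP e2 rest.
  by apply/connect1/edge_relP; exists e; rewrite // inE mem_head.
apply: (connect_trans (y := u)).
  by apply/connect1/edge_relP; exists e; rewrite // inE mem_head.
apply: edge_conn_sub (IH _ _ rest) => f; rewrite !inE => fes _.
by rewrite fes orbT.
Qed.

(** The other edges of a cycle would join the ends of its first edge, which is a bridge. *)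
Lemma star_acyclic vs es : ~~ graph_cycle (star H pi) vs es.
Proof.
apply/negP=> /and5P[es0 _ ue _]; case: es es0 ue => // e es _ /= /andP[ees _].
case: vs => [|v vs]; rewrite ?rot1_cons //; case: vs => [|u vs] /= /andP[/eqP e2 rest].
  by case/negP: (forest_bridge pi_f e2).
case/negP: (forest_bridge pi_f e2); rewrite edge_conn_sym.
apply: edge_conn_sub (walk_connected rest) => f; rewrite !inE => fes _.
by rewrite andbT; split=> //; apply: contraNneq ees => <-.
Qed.

Lemma star_connected :
    {in verts H &, forall x y, connect (edge_rel pi setT) x y} ->
  connected (star H pi).
Proof.
move=> c; apply/forallP=> X; apply/implyP=> /andP[/andP[/= sX /set0Pn[x xX]] XV].
have /subsetPn[y yV yX] : ~~ (verts H \subset X).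
  by apply: contra XV => sVX; rewrite eqEsubset sX.
have [u [v [/edge_relP[f _ ef] uX vX]]] :=
  connect_cut (c x y (subsetP sX x xX) yV) (xX : mem X x) yX.
have pif : pi f != set0 by apply/set0Pn; exists u; rewrite ef set21.
have [fE sub _] := shrinkingP pi_s pif.
apply/exists_inP; exists f; first by rewrite inE fE.
apply/andP; split; apply/set0Pn; [exists u|exists v]; rewrite !inE ef ?set21 //.
rewrite set22 vX /=; apply: (subsetP (subset_trans sub (ends_sub fE))).
by rewrite ef set22.
Qed.

Let cls l a := [set x in verts H | l x == a].

(** As long as the labeling is not closed, some hyperedge has its part in one class and reaches
    another, and the two tight sections unite into one. A closed labeling is constant, so the
    process ends with a single class. *)
Let merge_classes l :
    {in edges H, forall f, pi f = set0 -> constant_on l (ends H f)} ->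
    (forall a, a \in l @: verts H -> tight_complement pi (section H pi (cls l a))) ->
    (forall l', merge_closed (ends H) pi setT (~: edges H) l' ->
       constant_on l' (verts H)) ->
  verts H != set0 -> tight_complement pi (section H pi (verts H)).
Proof.
move=> + + labels V0; have [n] := ubnP #|l @: verts H|.
elim: n l => // n IHn l len unused tl.
have [lc|] := boolP (merge_closed (ends H) pi setT (~: edges H) l).
  have /set0Pn[x xV] := V0; have := tl (l x) (imset_f _ xV).
  suff -> : cls l (l x) = verts H by [].
  by apply/setP=> y; rewrite inE; apply: andb_idr => yV; rewrite (labels l lc y x).
rewrite /merge_closed negb_forall => /existsP[e]; rewrite negb_forall_in => /exists_inP[x xe].
rewrite negb_forall_in => /exists_inP[y ye]; rewrite negb_imply => /andP[].
rewrite in_setC negbK => /and4P[eE _ _ /forall_inP const] nlxy.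
have pie : pi e != set0.
  by apply: contraNneq nlxy => pi0; apply/eqP; apply: (unused e eE pi0).
have [_ sub c2] := shrinkingP pi_s pie.
have [z zpi] := set0Pn _ pie; pose a := l z.
have la w : w \in pi e -> l w = a.
  by move=> wpi; apply/esym/eqP; apply: (forall_inP (const z zpi)).
have [t te lt] : exists2 t, t \in ends H e & l t != a.
  by case: (eqVneq (l x) a) => [lx|lx]; [exists y; rewrite // -lx eq_sym|exists x].
pose b := l t; have nba : b != a := lt.
have eV := subsetP (ends_sub eE).
have zV : z \in verts H by apply/eV/(subsetP sub).
have aL : a \in l @: verts H by apply: imset_f.
have bL : b \in l @: verts H by apply/imset_f/eV.
pose l' : {ffun V -> V} := [ffun v => if l v == a then b else l v].
apply: (IHn l').
- have : l' @: verts H \subset l @: verts H :\ a.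
    apply/subsetP=> _ /imsetP[v vV ->]; rewrite ffunE !inE.
    by case: ifP => [_|lv]; rewrite ?nba // lv imset_f.
  move/subset_leq_card/leq_ltn_trans; apply.
  by move: len; rewrite (cardsD1 a) aL.
- move=> f fE pif u v uf vf; rewrite !ffunE.
  by rewrite (unused f fE pif u v uf vf).
move=> d /imsetP[v vV ->]; set d' := l' v.
have nd'a : d' != a by rewrite /d' ffunE; case: ifP => // ->.
case: (eqVneq d' b) => [->|d'b]; last first.
  have -> : cls l' d' = cls l d'.
    apply/setP=> u; rewrite !inE ffunE; case: (eqVneq (l u) a) => [->|//].
    by rewrite eq_sym (negPf d'b) eq_sym (negPf nd'a).
  apply: tl; apply/imsetP; exists v => //; rewrite /d' ffunE.
  by case: ifP => // lv; case/negP: d'b; rewrite /d' ffunE lv.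
have -> : cls l' b = cls l a :|: cls l b.
  apply/setP=> u; rewrite !inE ffunE; case: (u \in verts H) => //=.
  by case: (l u == a); rewrite // eqxx.
apply: (@tight_union _ _ pi H (cls l a) (cls l b) e) => //.
- by apply/set0Pn; exists z; rewrite inE zV eqxx.
- by apply/set0Pn; exists t; rewrite inE eV /=.
- rewrite -setI_eq0; apply/eqP/setP=> u; rewrite !inE.
  by case: eqP => [->|]; rewrite ?andbF // eq_sym (negPf nba) !andbF.
- exact: tl.
- exact: tl.
- by apply/subsetP=> w wpi; rewrite inE (la w wpi) eqxx andbT; apply/eV/(subsetP sub).
- by apply/set0Pn; exists t; rewrite !inE te eV //=.
Qed.

Lemma tight_labels :
    (forall l, merge_closed (ends H) pi setT (~: edges H) l -> constant_on l (verts H)) ->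
  tight_complement pi H.
Proof.
move=> labels; have [V0|V0] := eqVneq (verts H) set0.
  apply: TightConnected; apply/forallP=> X; apply/implyP.
  by rewrite /= V0 subset0 => /andP[/andP[-> //]].
pose un : rel V := fun x y => [exists f in edges H,
  [&& pi f == set0, x \in ends H f & y \in ends H f]].
have un_sym : connect_sym un.
  apply: sym_connect_sym => x y; apply: eq_existsb => f.
  by congr (_ && (_ && _)); rewrite andbC.
pose l : {ffun V -> V} := [ffun x => root un x].
have l_un x y : un x y -> l x = l y.
  by move=> uxy; rewrite !ffunE; apply/eqP; rewrite root_connect //; apply: connect1.
have tV : tight_complement pi (section H pi (verts H)).
  apply: (@merge_classes l) => //.
    move=> f fE pi0 x y xf yf; apply: l_un; apply/exists_inP; exists f => //.
    by rewrite pi0 eqxx xf.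
  move=> a _; apply: TightConnected; apply/forallP=> Y; apply/implyP.
  case/andP=> /andP[/= sY /set0Pn[x xY]] YX.
  have /subsetPn[y yX yY] : ~~ (cls l a \subset Y).
    by apply: contra YX => sXY; rewrite eqEsubset sY.
  have xX := subsetP sY x xY.
  have cxy : connect un x y.
    rewrite -root_connect //; move: xX yX; rewrite !inE !ffunE.
    by move=> /andP[_ /eqP->] /andP[_ /eqP->].
  have [u [v [uuv uY vY]]] := connect_cut cxy (xY : mem Y x) yY.
  have uX := subsetP sY u uY.
  have /exists_inP[f fE /and3P[/eqP pi0 uf vf]] := uuv.
  have vX : v \in cls l a.
    move: uX; rewrite !inE => /andP[_ /eqP <-].
    by rewrite (l_un _ _ uuv) eqxx andbT; apply: (subsetP (ends_sub fE)).
  have nuv : u != v by apply: contraNneq vY => <-.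
  apply/exists_inP; exists f.
    rewrite !inE fE pi0 sub0set eqxx !andbF !andbT /=.
    have : [set u; v] \subset ends H f :&: cls l a.
      by rewrite subUset !sub1set !in_setI uf vf uX vX.
    by move/subset_leq_card; rewrite cards2 nuv.
  apply/andP; split; apply/set0Pn; [exists u|exists v].
    by rewrite /= in_setI in_setI uf uX.
  by rewrite /= in_setI in_setI in_setD vf vX vY.
apply: eq_tight tV => [//| |f]; last first.
  by rewrite inE => /andP[fE _]; rewrite /= (setIidPl (ends_sub fE)).
apply/setP=> f; rewrite inE; case fE: (f \in edges H) => //=; apply/esym.
have [sub c23] := hH fE; rewrite (setIidPl sub).
apply/andP; split; first by case: c23 => ->.
by case: (quasigraph_forest fE) => s _; apply: subset_trans s sub.
Qed.

End Reading.

Theorem theorem5 (V E : finType) (H : hypergraph V E)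
  (hH : hypergraph3 H)
  (hconn : edge_connected 4 H)
  (hcut : forall (F : {set E}) (e : E),
     edge_cut H F -> #|F| = 4 -> e \in F -> #|ends H e| <> 3) :
  exists pi : E -> {set V}, quasitree H pi /\ tight_complement pi H.
Proof.
have card_s : [forall e in edges H, #|ends H e| <= 3].
  by apply/forall_inP=> e /hH[_ [] ->].
(* For every [pi] the partitions stall by stage [#|{: V * V}|], so this many stages of optimality
   can be fixed before [M] is known. *)
have [pi pi_opt] := optimal_exists (edges H) (ends H) #|{: V * V}|.+1.
have [M leM Rel_st] := stable_exists (edges H) (ends H) pi.
have {}pi_opt : optimal (edges H) (ends H) M.+1 pi := optimal_le (leM : M < _.+1) pi_opt.
have pi_f := pi_opt.1.
set P := Rel (edges H) (ends H) pi M in Rel_st.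
have eqCP : Comp (edges H) (ends H) pi M = P := stable_Comp Rel_st.
have P_conn x y : (x, y) \in P -> connect (edge_rel pi [set f | within P (pi f)]) x y.
  rewrite -{1}eqCP compsE; apply: edge_conn_sub => f.
  by rewrite [f \in alive _ _ _]in_set => /andP[_ wf] _; rewrite in_set.
have all_P := one_class hH hconn hcut pi_f (Rel_equiv _ _ _ _) P_conn
  (stable_acyclic card_s pi_opt Rel_st).
exists pi; split; first split.
- exact: quasigraph_forest pi_f.
- split; last exact: star_acyclic.
  apply: star_connected => // x y xV yV.
  by apply: edge_conn_sub (P_conn _ _ (all_P x y xV yV)) => f _; rewrite inE.
(* A labeling closed for the trivial partition is also closed at stage [M], where it is constant on
   the class that contains all vertices. *)
apply: tight_labels => // l lc x y xV yV.
apply: (stable_label Rel_st) (all_P x y xV yV).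
apply: (merge_closed_transfer card_s (forest_shrinking pi_f) _ lc) => //.
- by split=> *; rewrite inE.
- by rewrite -(Lost0 (edges H) (ends H) pi) Lost_sub.
- by rewrite -(Lost0 (edges H) (ends H) pi) Lost_sub.
by move=> e _; constructor 1.
Qed.
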